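(* Let $q$ be a prime power with $2 \mid q+1$, let $m=\frac{q+1}{2}$ and assume $m\ge 4$. Let $P$ be a place of $\mathcal{F}_m$ with $P\notin\mathcal{O}$, and assume that $P$ is $\mathbb{F}_{q^2}$-rational. Then the set of gaps at $P$ is $$G(P)=\left\{\, i+2j+k(q+1)+1 \ \middle|\ i,j,k\in\mathbb{Z}_{\ge 0},\ m-3-i-j-k\,\frac{q+1}{m}\ge 0 \,\right\}.$$
   Context: For a divisor $m$ of $q+1$, $\mathcal{F}_m=\overline{\mathbb{F}}_{q^2}(X,Y)$ is the Fermat function field defined by $X^m+Y^m+1=0$ over the algebraic closure $\overline{\mathbb{F}}_{q^2}$ of the field $\mathbb{F}_{q^2}$ with $q^2$ elements; its genus is $(m-1)(m-2)/2$. For $a,b\in\overline{\mathbb{F}}_{q^2}$ with $a^m+b^m+1=0$, $P_{(a,b)}$ denotes the common zero of $X-a$ and $Y-b$. Let $\alpha_1,\dots,\alpha_m\in\mathbb{F}_{q^2}$ be the $m$ roots of $t^m+1=0$, and let $P_\infty^1,\dots,P_\infty^m$ be the $m$ common poles of $X$ and $Y$. Set $\mathcal{O}=\{P_{(\alpha_i,0)},P_{(0,\alpha_i)},P_\infty^i \mid i=1,\dots,m\}$. Thus the places not in $\mathcal{O}$ are exactly the $P_{(a,b)}$ with $a^m+b^m+1=0$ and $ab\ne 0$. A place of $\mathcal{F}_m$ is called $\mathbb{F}_{q^2}$-rational if it can be identified with a rational (degree one) place of the function field $\mathbb{F}_{q^2}(X,Y)$ given by the same equation; for $P=P_{(a,b)}$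 this means $a,b\in\mathbb{F}_{q^2}$. For a place $P$, the Weierstrass semigroup $H(P)$ is the set of nonnegative integers $n$ for which there is a function $f\in\mathcal{F}_m$ with pole divisor $(f)_\infty=nP$, and the set of gaps is $G(P)=\mathbb{N}\setminus H(P)$. *)

(* Defs.v *)
From mathcomp Require Import all_boot all_order all_algebra.
From mathcomp Require Import boolp classical_sets.

Set Implicit Arguments.
Unset Strict Implicit.
Unset Printing Implicit Defensive.

Import Order.TTheory GRing.Theory Num.Theory.
Local Open Scope ring_scope.

Definition prime_power (q : nat) : Prop :=
  exists p k : nat, [/\ prime p, (0 < k)%N & q = (p ^ k)%N].

(* [z] lies in the subfield [f(k)(x, y)] of [L]. *)
Definition in_adjoin2 (k L : fieldType) (f : {rmorphism k -> L}) (x y z : L)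
    : Prop :=
  forall S : {pred L}, divring_closed S -> (forall c, f c \in S) ->
    x \in S -> y \in S -> z \in S.

(* [L = K(x, y)] with [x] transcendental over [K] and [x^m + y^m + 1 = 0].  When
   [m] is nonzero in the algebraically closed field [K], the polynomial
   [X^m + Y^m + 1] is irreducible over [K], so that this determines the extension
   [L / K] and the pair [(x, y)] up to unique isomorphism. *)
Definition fermat_function_field (K L : fieldType) (kappa : {rmorphism K -> L})
    (m : nat) (x y : L) : Prop :=
  [/\ x ^+ m + y ^+ m + 1 = 0,
      ~ algebraicOver kappa x
    & forall z : L, in_adjoin2 kappa x y z].

Section Places.

Variables (K L : fieldType) (kappa : {rmorphism K -> L}).

Definition valuation_ring (O : {pred L}) : Prop :=
  [/\ subring_closed O,
      forall c : K, kappa c \in O,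
      exists z : L, z \notin O
    & forall z : L, z \in O \/ z^-1 \in O].

(* A place is the maximal ideal of a valuation ring of [L / K]; as each of the
   two determines the other, a place is represented by its valuation ring. *)
Record place := Place {
  vring : {pred L};
  vringP : valuation_ring vring
}.

Lemma eq_place (P Q : place) : P = Q <-> vring P =i vring Q.
Proof.
split=> [-> //|]; case: P Q => [O hO] [O' hO'] /= eqO.
have eOO' : O = O' by apply/funext => z; exact: eqO.
by subst O'; congr Place; exact: Prop_irrelevance.
Qed.

Definition vunit (P : place) : {pred L} :=
  [pred z | [&& z != 0, z \in vring P & z^-1 \in vring P]].

Definition max_ideal (P : place) : {pred L} :=
  [pred z | (z \in vring P) && (z \notin vunit P)].

Definition prime_element (P : place) (t : L) : Prop :=
  forall z : L, z \in max_ideal P <-> exists2 w, w \in vring P & z = w * t.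

(* [v_P(z) = n]; never satisfied when [z = 0], where [v_P(0)] is infinite. *)
Definition valuation (P : place) (z : L) (n : int) : Prop :=
  exists t u : L, [/\ prime_element P t, u \in vunit P & z = u * t ^ n].

Definition divisor := place -> int.

Definition mult_place (n : nat) (P : place) : divisor :=
  fun Q => if `[< Q = P >] then n%:Z else 0.

(* [(f)_oo = D], which requires [f] to be nonzero. *)
Definition pole_divisor (f : L) (D : divisor) : Prop :=
  forall Q : place, exists2 k : int, valuation Q f k & D Q = Num.max 0 (- k).

Definition weierstrass_semigroup (P : place) : set nat :=
  [set n | exists f : L, pole_divisor f (mult_place n P)]%classic.

Definition gaps (P : place) : set nat := (~` weierstrass_semigroup P)%classic.

Definition is_zero (P : place) (z : L) : Prop := z \in max_ideal P.
Definition is_pole (P : place) (z : L) : Prop := z \notin vring P.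

(* The places of the Fermat function field lying over [X Y = 0] or infinity. *)
Definition in_calO (m : nat) (x y : L) (P : place) : Prop :=
  [\/ exists2 a : K, a ^+ m + 1 = 0 & is_zero P (x - kappa a) /\ is_zero P y,
      exists2 a : K, a ^+ m + 1 = 0 & is_zero P x /\ is_zero P (y - kappa a)
    | is_pole P x /\ is_pole P y].

End Places.

(* The restriction of [P] to the subfield [F(x, y)] has degree one, i.e., its
   residue field is [F]. *)
Definition rational_place (F K L : fieldType) (iota : {rmorphism F -> K})
    (kappa : {rmorphism K -> L}) (x y : L) (P : place kappa) : Prop :=
  forall z : L, in_adjoin2 (kappa \o iota) x y z -> z \in vring P ->
    exists c : F, z - kappa (iota c) \in max_ideal P.

(* Main.v *)
Require Import Defs.
From mathcomp Require Import all_boot all_order all_algebra.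
From mathcomp Require Import separable finfield.
From mathcomp Require Import boolp classical_sets.
From mathcomp Require Import ring lra zify.
From HB Require Import structures.

(** Write [P = (a, b)].  The rational points of the Hermitian curve
    [u^(q+1) + v^(q+1) + 1 = 0] have tangents of contact order [q + 1], and the curve
    covers the Fermat curve by [x = u^2], [y = v^2].  The four tangents at the points
    over [P] have as their product a conic [C] in [x] and [y], which therefore meets
    the Fermat curve in [P] alone, with multiplicity [q + 1 = 2 m].  Let [l] be the
    vertical line and [t] the tangent of the Fermat curve at [P]; they have the
    orders 1 and 2 there.

    The functions [l^i t^j / C^k] with [i + j <= 2 k] have [P] as their only pole and
    realise the pole numbers [k (q + 1) - s] with [0 <= s <= 4 k]
    ([nongap_of_exponents]).  Every other [n] has the form
    [i + 2 j + k (q + 1) + 1] with [i + j + 2 k + 3 <= m] ([gap_arith]), and such an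
    [n] is a gap ([gap_of_exponents]): if [f] had the pole divisor [n P], then
    [f C^(k+1)] would have poles at infinity only, of order at most [d = 2 k + 2],
    hence be a polynomial in [x] and [y] of degree at most [d] ([regular_poly],
    [degree_bound]).  Its order at [P] lies between [2 d + 1] and [q]; but modulo [C]
    such a polynomial reduces to a combination of [1, l, t, l t, t^2, ..., t^d], whose
    orders at [P] are the distinct numbers from 0 to [2 d] ([expandable_order]).

    Two ingredients carry this.  The first is a description of the places: in each of
    the charts [(x, y)], [(y, x)] and [(1/x, y/x)] the polynomials not vanishing at a
    point give a discrete valuation ring, every place is of this kind, and it is
    determined by its point ([exists_centered], [exists_valuation],
    [centered_vring]).  It rests on the linear independence of the powers [y^i],
    [i < m], over [K(x)] ([powers_free]).  The second is the multiplicity of the conic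
    ([conic_order]).  The square roots [u] and [v] need not lie in [L], but in
    characteristic [p] they have approximations in [L] to the order [q^2], for which
    the Hermitian computation goes through. *)

Set Implicit Arguments.
Unset Strict Implicit.
Unset Printing Implicit Defensive.

Import Order.TTheory GRing.Theory Num.Theory.
Local Open Scope ring_scope.

(** * Valuation rings and valuations *)

Section ValuationRings.

Variables (K L : fieldType) (kappa : {rmorphism K -> L}).
Implicit Types (P Q : place kappa) (z w t u : L) (n k : int).

Lemma vring_subring P : subring_closed (vring P).
Proof. by case: (vringP P) => [*]. Qed.

HB.instance Definition _ P :=
  GRing.isSubringClosed.Build L (vring P) (vring_subring P).

Lemma vring_const P c : kappa c \in vring P.
Proof. by case: (vringP P) => [*]. Qed.

Lemma vring_total P z : z \in vring P \/ z^-1 \in vring P.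
Proof. by case: (vringP P) => [*]. Qed.

Lemma vring_root P z m : (0 < m)%N -> z ^+ m \in vring P -> z \in vring P.
Proof.
move=> m_gt0 zmO; case: (vring_total P z) => // zVO.
have [->|z0] := eqVneq z 0; first exact: rpred0.
have -> : z = z ^+ m * z^-1 ^+ m.-1.
  by rewrite -{1}(prednK m_gt0) exprS -mulrA -exprMn divff // expr1n mulr1.
by rewrite rpredM // rpredX.
Qed.

Lemma vunitP P z :
  reflect [/\ z != 0, z \in vring P & z^-1 \in vring P] (z \in vunit P).
Proof. exact: and3P. Qed.

Lemma vunit_neq0 P u : u \in vunit P -> u != 0.
Proof. by case/vunitP. Qed.

Lemma vunit_vring P u : u \in vunit P -> u \in vring P.
Proof. by case/vunitP. Qed.

Lemma vunitM P u w : u \in vunit P -> w \in vunit P -> u * w \in vunit P.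
Proof.
move=> /vunitP[u0 uO uVO] /vunitP[w0 wO wVO]; apply/vunitP.
by split; rewrite ?mulf_neq0 ?rpredM // invfM rpredM.
Qed.

Lemma vunitV P u : u \in vunit P -> u^-1 \in vunit P.
Proof.
by move=> /vunitP[u0 uO uVO]; apply/vunitP; split; rewrite ?invrK ?invr_eq0.
Qed.

Lemma vunit1 P : 1 \in vunit P.
Proof. by apply/vunitP; split; rewrite ?oner_neq0 ?invr1 ?rpred1. Qed.

Lemma vunitX P u (n : nat) : u \in vunit P -> u ^+ n \in vunit P.
Proof.
move=> uU; elim: n => [|n IH]; first by rewrite expr0 vunit1.
by rewrite exprS vunitM.
Qed.

Lemma vunitXz P u n : u \in vunit P -> u ^ n \in vunit P.
Proof.
by move=> uU; case: n => n; rewrite ?NegzE -?exprnN ?vunitV // vunitX.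
Qed.

Lemma vunit_const P c : c != 0 -> kappa c \in vunit P.
Proof.
by move=> c0; apply/vunitP; rewrite fmorph_eq0 -fmorphV !vring_const; split.
Qed.

Lemma max_idealP P z :
  reflect (z \in vring P /\ (z != 0 -> z^-1 \notin vring P))
          (z \in max_ideal P).
Proof.
apply: (iffP andP) => [[zO zU]|[zO zV]]; split=> //.
  by move=> z0; apply: contra zU => zVO; apply/vunitP.
by apply/negP => /vunitP[z0 _]; apply/negP/zV.
Qed.

Lemma max_ideal_vring P z : z \in max_ideal P -> z \in vring P.
Proof. by case/andP. Qed.

Lemma max_idealN_vunit P z : z \in max_ideal P -> z \notin vunit P.
Proof. by case/andP. Qed.

Lemma vunitE P z : z \in vring P -> (z \in vunit P) = (z \notin max_ideal P).
Proof. by rewrite [z \in max_ideal P]inE => ->; rewrite negbK. Qed.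

Lemma max_ideal0 P : 0 \in max_ideal P.
Proof. by apply/max_idealP; rewrite rpred0 eqxx. Qed.

Lemma max_idealMl P w z :
  w \in vring P -> z \in max_ideal P -> w * z \in max_ideal P.
Proof.
move=> wO /max_idealP[zO zV]; apply/max_idealP; split; first exact: rpredM.
rewrite mulf_eq0 negb_or => /andP[w0 z0]; apply: contra (zV z0).
by rewrite invfM => /(rpredM wO); rewrite mulrA divff ?mul1r.
Qed.

Lemma max_idealMr P w z :
  w \in vring P -> z \in max_ideal P -> z * w \in max_ideal P.
Proof. by rewrite mulrC; exact: max_idealMl. Qed.

(** Whichever of [w / z] and [z / w] is integral, the sum is a multiple of the other
    summand. *)
Lemma max_idealD P z w :
  z \in max_ideal P -> w \in max_ideal P -> z + w \in max_ideal P.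
Proof.
move=> zM wM.
have [->|z0] := eqVneq z 0; first by rewrite add0r.
have [->|w0] := eqVneq w 0; first by rewrite addr0.
case: (vring_total P (w / z)) => [dO|].
  have -> : z + w = (1 + w / z) * z by rewrite mulrDl mul1r divfK.
  by rewrite max_idealMl // rpredD ?rpred1.
rewrite invf_div => dO.
have -> : z + w = (z / w + 1) * w by rewrite mulrDl mul1r divfK.
by rewrite max_idealMl // rpredD ?rpred1.
Qed.

Lemma max_idealN P z : z \in max_ideal P -> - z \in max_ideal P.
Proof. by rewrite -mulN1r; apply: max_idealMl; rewrite rpredN1. Qed.

Lemma max_idealB P z w :
  z \in max_ideal P -> w \in max_ideal P -> z - w \in max_ideal P.
Proof. by move=> zM wM; rewrite max_idealD ?max_idealN. Qed.

Lemma max_idealX P z (n : nat) :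
  (0 < n)%N -> z \in max_ideal P -> z ^+ n \in max_ideal P.
Proof.
by case: n => // n _ zM; rewrite exprS max_idealMr ?rpredX // max_ideal_vring.
Qed.

Lemma max_ideal_sum P (I : Type) (r : seq I) (F : I -> L) :
  (forall i, F i \in max_ideal P) -> \sum_(i <- r) F i \in max_ideal P.
Proof.
by move=> FM; elim/big_ind: _ => //; [exact: max_ideal0 | exact: max_idealD].
Qed.

Lemma max_ideal_const P c : kappa c \in max_ideal P -> c = 0.
Proof.
move=> cM; apply/eqP/negPn/negP => /(vunit_const P).
exact/negP/max_idealN_vunit.
Qed.

Lemma vunitD P u z : u \in vunit P -> z \in max_ideal P -> u + z \in vunit P.
Proof.
move=> uU zM; rewrite vunitE; last by rewrite rpredD ?(vunit_vring uU) ?max_ideal_vring.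
apply: contraL uU => uzM; apply: max_idealN_vunit.
by rewrite -[u](addrK z) max_idealB.
Qed.

Lemma vunit_cong P z c : z - kappa c \in max_ideal P -> c != 0 -> z \in vunit P.
Proof.
by move=> zM /(vunit_const P)/vunitD/(_ zM); rewrite addrC subrK.
Qed.

Lemma max_ideal_congD P z c w d :
  z - kappa c \in max_ideal P -> w - kappa d \in max_ideal P ->
  (z + w) - kappa (c + d) \in max_ideal P.
Proof.
move=> zM wM; have -> : z + w - kappa (c + d) = (z - kappa c) + (w - kappa d).
  by rewrite rmorphD /=; ring.
exact: max_idealD.
Qed.

Lemma max_ideal_congB P z c w d :
  z - kappa c \in max_ideal P -> w - kappa d \in max_ideal P ->
  (z - w) - kappa (c - d) \in max_ideal P.
Proof.
move=> zM wM; have -> : z - w - kappa (c - d) = (z - kappa c) - (w - kappa d).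
  by rewrite rmorphB /=; ring.
exact: max_idealB.
Qed.

Lemma max_ideal_congM P z c w d :
  z - kappa c \in max_ideal P -> w - kappa d \in max_ideal P ->
  z * w - kappa (c * d) \in max_ideal P.
Proof.
move=> zM wM.
have -> : z * w - kappa (c * d) = (z - kappa c) * w + kappa c * (w - kappa d).
  by rewrite rmorphM /=; ring.
have wO : w \in vring P.
  by rewrite -(subrK (kappa d) w) rpredD ?vring_const // max_ideal_vring.
by apply: max_idealD; [apply: max_idealMr | apply: max_idealMl (vring_const _ _) _].
Qed.

Lemma max_ideal_congX P z c (n : nat) :
  z - kappa c \in max_ideal P -> z ^+ n - kappa (c ^+ n) \in max_ideal P.
Proof.
move=> zM; elim: n => [|n IH]; first by rewrite !expr0 rmorph1 subrr max_ideal0.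
by rewrite !exprS max_ideal_congM.
Qed.

Lemma max_idealV P z : z \notin vring P -> z^-1 \in max_ideal P.
Proof.
move=> zO; apply/max_idealP; split; last by rewrite invrK.
by case: (vring_total P z) => // /(negP zO).
Qed.

Lemma prime_max_ideal P t : prime_element P t -> t \in max_ideal P.
Proof. by move=> tP; apply/tP; exists 1; rewrite ?rpred1 ?mul1r. Qed.

Lemma prime_neq0 P t : prime_element P t -> t != 0.
Proof.
move=> tP; apply/eqP => t0; case: (vringP P) => _ _ [z zO] _.
have /tP[w _] := max_idealV zO; rewrite t0 mulr0 => /eqP; rewrite invr_eq0.
by move=> /eqP z0; rewrite z0 rpred0 in zO.
Qed.

Lemma prime_ratio P t s : prime_element P t -> prime_element P s ->
  s / t \in vunit P.
Proof.
move=> tP sP; have t0 := prime_neq0 tP; have s0 := prime_neq0 sP.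
have /tP[w wO sE] := prime_max_ideal sP.
have /sP[v vO tE] := prime_max_ideal tP.
apply/vunitP; split; first by rewrite mulf_neq0 ?invr_eq0.
  by rewrite sE mulfK.
by rewrite invf_div tE mulfK.
Qed.

Lemma valuationP P t z n : prime_element P t ->
  valuation P z n <-> exists2 u, u \in vunit P & z = u * t ^ n.
Proof.
move=> tP; split=> [[s [u [sP uU ->]]]|[u uU ->]]; last by exists t, u.
exists (u * (s / t) ^ n); first by rewrite vunitM // vunitXz // prime_ratio.
by rewrite -mulrA -expfzMl divfK ?(prime_neq0 tP).
Qed.

Lemma valuation_prime P t : prime_element P t -> valuation P t 1.
Proof. by move=> tP; exists t, 1; rewrite vunit1 mul1r expr1z. Qed.

Lemma valuation_neq0 P z n : valuation P z n -> z != 0.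
Proof.
move=> [t [u [tP uU ->]]].
by rewrite mulf_neq0 ?(vunit_neq0 uU) // expfz_neq0 ?(prime_neq0 tP).
Qed.

Lemma valuation_vunit P u z n :
  valuation P z n -> u \in vunit P -> valuation P u 0.
Proof. by move=> [t [_ [tP _ _]]] uU; exists t, u; rewrite expr0z mulr1. Qed.

Lemma valuationM P z n w k :
  valuation P z n -> valuation P w k -> valuation P (z * w) (n + k).
Proof.
move=> [t [u [tP uU ->]]] /(valuationP _ _ tP)[v vU ->].
exists t, (u * v); split=> //; first exact: vunitM.
by rewrite expfzDr ?(prime_neq0 tP) //; ring.
Qed.

Lemma valuation_unitM P u z n :
  u \in vunit P -> valuation P z n -> valuation P (u * z) n.
Proof.
move=> uU zn; have un := valuation_vunit zn uU.
by have := valuationM un zn; rewrite add0r.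
Qed.

Lemma valuationV P z n : valuation P z n -> valuation P z^-1 (- n).
Proof.
move=> [t [u [tP uU ->]]]; exists t, u^-1; split=> //; first exact: vunitV.
by rewrite invfM invr_expz.
Qed.

Lemma valuationX P z n e :
  valuation P z n -> valuation P (z ^+ e) (n * e%:Z).
Proof.
move=> zn; elim: e => [|e IH].
  by rewrite expr0 mulr0; apply: valuation_vunit zn (vunit1 P).
rewrite exprS; have -> : n * e.+1%:Z = n + n * e%:Z by rewrite intS; ring.
exact: valuationM.
Qed.

Lemma valuation_max_ideal P z n :
  valuation P z n -> 0 < n -> z \in max_ideal P.
Proof.
move=> [t [u [tP uU ->]]]; case: n => // n n_gt0.
by rewrite max_idealMl ?vunit_vring // max_idealX // prime_max_ideal.
Qed.

Lemma valuation0_vunit P z : valuation P z 0 -> z \in vunit P.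
Proof. by move=> [t [u [_ uU ->]]]; rewrite expr0z mulr1. Qed.

Lemma valuation_vring P z n : valuation P z n -> (z \in vring P) = (0 <= n).
Proof.
move=> zn; case: (ltrgtP n 0) => [n_lt0|n_gt0|n0].
- apply/negP => zO; have zVn := valuationV zn.
  have /max_idealP[_] := valuation_max_ideal zVn ltac:(by rewrite oppr_gt0).
  by rewrite invrK invr_eq0 (valuation_neq0 zn) => /(_ isT); rewrite zO.
- by rewrite max_ideal_vring // (valuation_max_ideal zn).
- by rewrite vunit_vring // valuation0_vunit // -n0.
Qed.

(** The strict triangle equality; comparing [w] with [z] by their quotient admits
    [w = 0], which has no valuation. *)
Lemma valuationD P z w n :
  valuation P z n -> w / z \in max_ideal P -> valuation P (z + w) n.
Proof.
move=> zn wzM; have z0 := valuation_neq0 zn.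
have -> : z + w = (1 + w / z) * z by rewrite mulrDl mul1r divfK.
by apply: valuation_unitM => //; rewrite vunitD ?vunit1.
Qed.

End ValuationRings.

(** * Evaluation of plane polynomials *)

Lemma poly_split (R : nzRingType) (p : {poly R}) :
  exists (q : {poly R}) (c : R), p = q * 'X + c%:P.
Proof.
elim/poly_ind: p => [|q c _]; last by exists q, c.
by exists 0, 0; rewrite mul0r add0r polyC0.
Qed.

Section Evaluation.

Variables (K L : fieldType) (kappa : {rmorphism K -> L}).

(** The evaluation maps are locked: unification would otherwise unfold polynomial
    arithmetic whenever it looks for a morphism. *)
Definition evX (x : L) (c : {poly K}) : L := locked (map_poly kappa c).[x].

Lemma evXE x c : evX x c = (map_poly kappa c).[x].
Proof. by rewrite /evX -lock. Qed.

Fact evX_zmod x : zmod_morphism (evX x).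
Proof. by move=> p q; rewrite !evXE rmorphB hornerD hornerN. Qed.
Fact evX_monoid x : monoid_morphism (evX x).
Proof. by split=> [|p q]; rewrite !evXE ?rmorph1 ?hornerC // rmorphM hornerM. Qed.
HB.instance Definition _ x :=
  GRing.isZmodMorphism.Build {poly K} L (evX x) (evX_zmod x).
HB.instance Definition _ x :=
  GRing.isMonoidMorphism.Build {poly K} L (evX x) (evX_monoid x).

Lemma evX_0 x : evX x 0 = 0. Proof. exact: rmorph0. Qed.
Lemma evX_1 x : evX x 1 = 1. Proof. exact: rmorph1. Qed.
Lemma evX_D x c d : evX x (c + d) = evX x c + evX x d.
Proof. exact: rmorphD. Qed.
Lemma evX_N x c : evX x (- c) = - evX x c. Proof. exact: rmorphN. Qed.
Lemma evX_B x c d : evX x (c - d) = evX x c - evX x d.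
Proof. exact: rmorphB. Qed.
Lemma evX_M x c d : evX x (c * d) = evX x c * evX x d.
Proof. exact: rmorphM. Qed.
Lemma evX_exp x c n : evX x (c ^+ n) = evX x c ^+ n.
Proof. exact: rmorphXn. Qed.

Definition ev (x y : L) (p : {poly {poly K}}) : L :=
  locked (map_poly (evX x) p).[y].

Lemma evE x y p : ev x y p = (map_poly (evX x) p).[y].
Proof. by rewrite /ev -lock. Qed.

Fact ev_zmod x y : zmod_morphism (ev x y).
Proof. by move=> p q; rewrite !evE rmorphB hornerD hornerN. Qed.
Fact ev_monoid x y : monoid_morphism (ev x y).
Proof. by split=> [|p q]; rewrite !evE ?rmorph1 ?hornerC // rmorphM hornerM. Qed.
HB.instance Definition _ x y :=
  GRing.isZmodMorphism.Build {poly {poly K}} L (ev x y) (ev_zmod x y).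
HB.instance Definition _ x y :=
  GRing.isMonoidMorphism.Build {poly {poly K}} L (ev x y) (ev_monoid x y).

Lemma ev_0 x y : ev x y 0 = 0. Proof. exact: rmorph0. Qed.
Lemma ev_1 x y : ev x y 1 = 1. Proof. exact: rmorph1. Qed.
Lemma ev_D x y p q : ev x y (p + q) = ev x y p + ev x y q.
Proof. exact: rmorphD. Qed.
Lemma ev_N x y p : ev x y (- p) = - ev x y p. Proof. exact: rmorphN. Qed.
Lemma ev_B x y p q : ev x y (p - q) = ev x y p - ev x y q.
Proof. exact: rmorphB. Qed.
Lemma ev_M x y p q : ev x y (p * q) = ev x y p * ev x y q.
Proof. exact: rmorphM. Qed.
Lemma ev_exp x y p n : ev x y (p ^+ n) = ev x y p ^+ n.
Proof. exact: rmorphXn. Qed.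

Definition evK (a b : K) (p : {poly {poly K}}) : K := locked p.[b%:P].[a].

Lemma evKE a b p : evK a b p = p.[b%:P].[a].
Proof. by rewrite /evK -lock. Qed.

Fact evK_zmod a b : zmod_morphism (evK a b).
Proof. by move=> p q; rewrite !evKE !(hornerD, hornerN). Qed.
Fact evK_monoid a b : monoid_morphism (evK a b).
Proof. by split=> [|p q]; rewrite !evKE ?hornerC // !hornerM. Qed.
HB.instance Definition _ a b :=
  GRing.isZmodMorphism.Build {poly {poly K}} K (evK a b) (evK_zmod a b).
HB.instance Definition _ a b :=
  GRing.isMonoidMorphism.Build {poly {poly K}} K (evK a b) (evK_monoid a b).

Lemma evX_C x c : evX x c%:P = kappa c.
Proof. by rewrite evXE map_polyC hornerC. Qed.
Lemma evX_X x : evX x 'X = x.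
Proof. by rewrite evXE map_polyX hornerX. Qed.
Lemma evX_XsubC x a : evX x ('X - a%:P) = x - kappa a.
Proof. by rewrite rmorphB /= evX_X evX_C. Qed.

Lemma ev_C x y c : ev x y c%:P = evX x c.
Proof. by rewrite evE map_polyC hornerC. Qed.
Lemma ev_X x y : ev x y 'X = y.
Proof. by rewrite evE map_polyX hornerX. Qed.

Lemma evK_C a b c : evK a b c%:P = c.[a].
Proof. by rewrite evKE hornerC. Qed.
Lemma evK_1 a b : evK a b 1 = 1. Proof. exact: rmorph1. Qed.
Lemma evK_D a b p q : evK a b (p + q) = evK a b p + evK a b q.
Proof. exact: rmorphD. Qed.
Lemma evK_B a b p q : evK a b (p - q) = evK a b p - evK a b q.
Proof. exact: rmorphB. Qed.
Lemma evK_M a b p q : evK a b (p * q) = evK a b p * evK a b q.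
Proof. exact: rmorphM. Qed.
Lemma evK_exp a b p n : evK a b (p ^+ n) = evK a b p ^+ n.
Proof. exact: rmorphXn. Qed.
Lemma evK_X a b : evK a b 'X = b.
Proof. by rewrite evKE hornerX hornerC. Qed.

Lemma ev_coef_wide x y (p : {poly {poly K}}) n : (size p <= n)%N ->
  ev x y p = \sum_(i < n) evX x p`_i * y ^+ i.
Proof.
move=> sp; rewrite evE (@horner_coef_wide _ n); last first.
  exact: leq_trans (size_poly _ _) sp.
by apply: eq_bigr => i _; rewrite coef_map.
Qed.

Lemma evX_coef_wide x (c : {poly K}) n : (size c <= n)%N ->
  evX x c = \sum_(i < n) kappa c`_i * x ^+ i.
Proof.
move=> sc; rewrite evXE (@horner_coef_wide _ n) ?size_map_poly //.
by apply: eq_bigr => i _; rewrite coef_map.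
Qed.

Lemma ev_compose x y (p h : {poly {poly K}}) : exists s : {poly {poly K}},
  (map_poly (evX x) p).[ev x y h] = ev x y s.
Proof.
exists (map_poly polyC p).[h]; rewrite -horner_map -map_poly_comp /=.
by congr (_.[_]); apply: eq_map_poly => c; rewrite /= ev_C.
Qed.

(** First-order Taylor expansion at a point. *)
Lemma taylor1 (a b : K) (p : {poly {poly K}}) : exists p1 p2 : {poly {poly K}},
  p = ('X - a%:P)%:P * p1 + ('X - (b%:P)%:P) * p2 + (evK a b p)%:P%:P.
Proof.
have /factor_theorem[p2 p2E] : root (p - p.[b%:P]%:P) b%:P.
  by rewrite rootE hornerD hornerN hornerC subrr.
have /factor_theorem[c cE] : root (p.[b%:P] - (evK a b p)%:P) a.
  by rewrite rootE hornerD hornerN hornerC evKE subrr.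
exists c%:P, p2; rewrite -polyCM [_ * c]mulrC -cE [_ * p2]mulrC -p2E polyCB.
by ring.
Qed.

End Evaluation.

Arguments ev {K L} kappa x y.
Arguments evX {K L} kappa x.

(** * Relations between the generators of the Fermat function field *)

Section FermatField.

Variables (K : closedFieldType) (L : fieldType) (kappa : {rmorphism K -> L}).
Variables (m : nat) (x y : L).
Hypotheses (m_gt0 : (0 < m)%N) (m_neq0 : m%:R != 0 :> K).
Hypothesis L_fermat : fermat_function_field kappa m x y.

Local Notation evx := (evX kappa x).
Local Notation evxy := (ev kappa x y).

Lemma fermat_eq : y ^+ m = - (x ^+ m + 1).
Proof.
by case: L_fermat => e _ _; apply/eqP; rewrite -subr_eq0 -e; apply/eqP; ring.
Qed.

Lemma evx_eq0 c : evx c = 0 -> c = 0.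
Proof.
case: L_fermat => _ x_tr _ c0; apply/eqP/negPn/negP => cN0; apply: x_tr.
by exists c => //; apply/rootP; rewrite -evXE.
Qed.

Lemma evx_neq0 c : c != 0 -> evx c != 0.
Proof. by apply: contra => /eqP/evx_eq0 ->. Qed.

Lemma subr_const_neq0 a : x - kappa a != 0.
Proof. by rewrite -evX_XsubC evx_neq0 // polyXsubC_eq0. Qed.

Lemma fermat_y_neq0 : y != 0.
Proof.
apply/eqP => y0; have := fermat_eq; rewrite y0 expr0n; case: posnP m_gt0 => //= _ _.
have -> : x ^+ m + 1 = evx ('X^m + 1%:P).
  by rewrite evX_D evX_exp evX_X evX_C rmorph1.
move/esym/eqP; rewrite oppr_eq0 => /eqP/evx_eq0/eqP; apply/negP.
by rewrite -size_poly_eq0 size_XnaddC.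
Qed.

Lemma ev_integral p : integralOver evx (evxy p).
Proof.
rewrite evE; apply: integral_horner => [c /(nthP 0)[i _ <-]|].
  by rewrite coef_map; apply: integral_id.
exists ('X^m + ('X^m + 1)%:P); first exact: monicXnaddC.
apply/rootP; rewrite rmorphD rmorphXn /= map_polyX map_polyC /= !hornerE.
by rewrite evX_D evX_exp evX_X evX_1 fermat_eq addNr.
Qed.

(** The polynomial [N] is the constant term of an integral equation of [h], once
    powers of the variable have been divided out of it. *)
Lemma ev_dvd_evx h : evxy h != 0 ->
  exists (N : {poly K}) (s : {poly {poly K}}), N != 0 /\ evx N = evxy h * evxy s.
Proof.
move=> h0; have [p p_mon /rootP] := ev_integral h.
elim/poly_ind: p p_mon => [|p c IH] p_mon.
  by rewrite monicE lead_coef0 eq_sym oner_eq0 in p_mon.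
rewrite rmorphD rmorphM /= map_polyX map_polyC !hornerE /= => pE.
have [c0|c0] := eqVneq c 0.
  apply: IH; last first.
    move: pE; rewrite c0 rmorph0 addr0 => /eqP.
    by rewrite mulf_eq0 (negPf h0) orbF => /eqP.
  by move: p_mon; rewrite c0 addr0 monicMr ?monicX.
have [s sE] := ev_compose kappa x y p h; exists c, (- s); split=> //.
by rewrite ev_N mulrN -sE mulrC; apply/eqP; rewrite -addr_eq0 addrC pE.
Qed.

(** The fractions with denominator in [K[x]] form a field, because an inverse of
    [K[x, y]] gets such a denominator from [ev_dvd_evx]. *)
Lemma fractionP z :
  exists (d : {poly K}) (h : {poly {poly K}}), d != 0 /\ z * evx d = evxy h.
Proof.
case: L_fermat => _ _ /(_ z).
pose S := [pred z | `[< exists d h, d != 0 /\ z * evx d = evxy h >]].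
move=> /(_ S) Sz; apply/asboolP; apply: Sz => [|c||].
- split=> [|u v /asboolP[d [h [d0 dE]]] /asboolP[e [k [e0 eE]]]
           |u v /asboolP[d [h [d0 dE]]] /asboolP[e [k [e0 eE]]]].
  + by apply/asboolP; exists 1, 1; rewrite oner_neq0 evX_1 ev_1 mulr1.
  + apply/asboolP; exists (d * e), (h * e%:P - k * d%:P).
    rewrite mulf_neq0 // ev_B !ev_M !ev_C -dE -eE; split=> //; ring.
  + apply/asboolP; have [->|v0] := eqVneq v 0.
      by exists 1, 0; rewrite oner_neq0 ev_0 invr0 mulr0 mul0r.
    have k0 : evxy k != 0 by rewrite -eE mulf_neq0 ?evx_neq0.
    have [N [s [N0 NE]]] := ev_dvd_evx k0.
    exists (N * d), (h * e%:P * s); split; first exact: mulf_neq0.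
    rewrite !evX_M !ev_M ev_C NE -dE -eE.
    by rewrite -[RHS](divfK v0); field.
- by apply/asboolP; exists 1, c%:P%:P; rewrite oner_neq0 evX_1 mulr1 ev_C evX_C.
- by apply/asboolP; exists 1, 'X%:P; rewrite oner_neq0 evX_1 mulr1 ev_C evX_X.
- by apply/asboolP; exists 1, 'X; rewrite oner_neq0 evX_1 mulr1 ev_X.
Qed.

(** As [h^m] is [- (X^m + 1) s^m], clearing denominators in the integral equation of
    [s^m] gives an identity in [K[x]], all of whose terms but a power of [h] are
    divisible by [X^m + 1]. *)
Lemma ramified_vanish a h s :
  a ^+ m + 1 = 0 -> evx h = y * evxy s -> h.[a] = 0.
Proof.
move=> a_root hE; pose c : {poly K} := - ('X^m + 1).
have cE : evx c = y ^+ m.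
  by rewrite fermat_eq evX_N evX_D evX_exp evX_X evX_1.
have ca : c.[a] = 0 by rewrite /c !hornerE a_root oppr0.
have [p p_mon /rootP pE] := ev_integral (s ^+ m).
have pN0 : p != 0 := monic_neq0 p_mon.
pose n := (size p).-1; have szp : size p = n.+1 by rewrite polySpred.
pose q := \sum_(j < n.+1) p`_j * c ^+ (n - j) * h ^+ (m * j).
have q0 : q = 0.
  apply: evx_eq0; rewrite rmorph_sum /= -[RHS](mulr0 (evx c ^+ n)) -{2}pE.
  rewrite (@horner_coef_wide _ n.+1) ?(leq_trans (size_poly _ _)) ?szp //.
  rewrite mulr_sumr; apply: eq_bigr => j _; rewrite coef_map /=.
  rewrite !evX_M !evX_exp hE exprM exprMn -cE exprMn.
  have -> : evx c ^+ n = evx c ^+ (n - j) * evx c ^+ j.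
    by rewrite -exprD subnK // -ltnS.
  by rewrite ev_exp; ring.
have : q.[a] = 0 by rewrite q0 horner0.
rewrite /q big_ord_recr /= subnn expr0 mulr1 hornerD horner_sum big1 => [|j _].
  have -> : p`_n = 1 by move/monicP: p_mon.
  by rewrite add0r mul1r horner_exp => /eqP; rewrite expf_eq0 => /andP[_ /eqP].
rewrite 2!hornerM [X in _ * X * _]horner_exp ca expr0n subn_eq0 leqNgt ltn_ord.
by rewrite mulr0 mul0r.
Qed.

Lemma exists_root c : exists a : K, a ^+ m = c.
Proof.
have [a aE] := @solve_monicpoly K m (fun i => if i == 0%N then c else 0) m_gt0.
exists a; rewrite aE (bigD1 (Ordinal m_gt0)) //= expr0 mulr1 big1 ?addr0 // => i.
by rewrite -val_eqE /= => /negPf ->; rewrite mul0r.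
Qed.

(** The cofactor takes at [a] the value [m a^(m-1)] of the derivative. *)
Lemma cofactor_root a : a ^+ m + 1 = 0 ->
  exists2 e : {poly K}, 'X^m + 1 = ('X - a%:P) * e & e.[a] != 0.
Proof.
move=> a_root.
have a0 : a != 0.
  by apply: contra_eq_neq a_root => ->; rewrite expr0n gtn_eqF // add0r oner_neq0.
exists (\sum_(i < m) 'X^(m.-1 - i) * a%:P ^+ i).
  have am : a ^+ m = -1 by apply/eqP; rewrite -addr_eq0 a_root.
  by rewrite -subrXX -polyC_exp am polyCN opprK polyC1.
rewrite horner_sum (eq_bigr (fun=> a ^+ m.-1)) => [|i _].
  by rewrite sumr_const card_ord -mulr_natl mulf_neq0 ?expf_neq0.
rewrite -polyC_exp hornerM hornerXn hornerC -exprD subnK //.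
by rewrite -ltnS prednK.
Qed.

Lemma relation_vanish0 (a : K) (r : {poly {poly K}}) :
  a ^+ m + 1 = 0 -> evxy r = 0 -> (r`_0).[a] = 0.
Proof.
move=> a_root r0; have [q [c rE]] := poly_split r.
rewrite rE coefD coefMX coefC add0r; apply: (@ramified_vanish a _ (- q) a_root).
move: r0; rewrite rE ev_D ev_M ev_X ev_C ev_N => /eqP.
by rewrite addrC addr_eq0 => /eqP ->; rewrite mulrN mulrC.
Qed.

(** Dividing a relation by [y] permutes the coefficients cyclically, up to units
    at [a], so that each of them in turn becomes the constant coefficient. *)
Lemma relation_vanish (a : K) (r : {poly {poly K}}) k : a ^+ m + 1 = 0 ->
  (size r <= m)%N -> evxy r = 0 -> (k < m)%N -> (r`_k).[a] = 0.
Proof.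
move=> a_root; have [e eE ea] := cofactor_root a_root.
elim: k r => [|k IH] r sz_r r0 k_lt; first exact: relation_vanish0.
have [q [c rE]] := poly_split r.
have qE j : q`_j = r`_j.+1 by rewrite rE coefD coefMX coefC addr0.
have cE : c = r`_0 by rewrite rE coefD coefMX coefC add0r.
have /factor_theorem[c' c'E] : root c a.
  by rewrite rootE cE; apply/eqP/relation_vanish0.
(* [e] times the relation is [y] times [r'], since [(x - a) e = - y^m]. *)
pose r' := q * e%:P - c'%:P * 'X^(m.-1).
have r'E j : r'`_j = r`_j.+1 * e - c' * (j == m.-1)%:R.
  by rewrite coefB coefMC coefCM coefXn qE.
have := IH r' _ _ (ltnW k_lt); rewrite r'E ltn_eqF; last by lia.
rewrite mulr0 subr0 hornerM => r'_van.
have /eqP : (r`_k.+1).[a] * e.[a] = 0.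
  apply: r'_van.
    apply/leq_sizeP => j m_le_j; rewrite r'E (nth_default _ (leq_trans sz_r _)).
      by rewrite mul0r gtn_eqF ?mulr0 ?subr0 //; lia.
    exact: leqW.
  apply: (mulfI fermat_y_neq0); rewrite mulr0 ev_B !ev_M !ev_C ev_exp ev_X.
  rewrite mulrBr [y * (evx c' * _)]mulrCA -exprS prednK // fermat_eq.
  have -> : x ^+ m + 1 = (x - kappa a) * evx e.
    by rewrite -evX_XsubC -evX_M -eE evX_D evX_exp evX_X evX_1.
  have: evxy q * y = - evx c.
    apply/eqP; rewrite -addr_eq0 -(ev_C kappa x y).
    by rewrite -[X in _ * X](ev_X kappa x y) -ev_M -ev_D -rE r0.
  rewrite c'E evX_M evX_XsubC => yq.
  by rewrite mulrA [y * _]mulrC yq; ring.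
by rewrite mulf_eq0 (negPf ea) orbF => /eqP.
Qed.

(** Some root [a] of [X^m + 1] exists, and all coefficients of a relation vanish at
    it; dividing them by [X - a] again and again shows that they are 0. *)
Lemma powers_free (r : {poly {poly K}}) :
  (size r <= m)%N -> evxy r = 0 -> r = 0.
Proof.
have [a aE] := exists_root (-1); have a_root : a ^+ m + 1 = 0 by rewrite aE addNr.
(* Induction on a bound [n] for the size of the coefficient. *)
suff free (n : nat) : forall r : {poly {poly K}}, (size r <= m)%N -> evxy r = 0 ->
    forall i : nat, (size (r`_i)%R <= n)%N -> r`_i = 0.
  by move=> sz_r r0; apply/polyP => i; rewrite coef0; apply: free sz_r r0 i (leqnn _).
elim: n => [|n IH] {}r sz_r r0 i.
  by rewrite size_poly_leq0 => /eqP.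
move=> sz_ri; have [->//|ri0] := eqVneq r`_i 0.
pose r' := \poly_(j < m) (r`_j %/ ('X - a%:P)).
have rE : r = ('X - a%:P)%:P * r'.
  apply/polyP => j; rewrite coefCM coef_poly; case: ltnP => j_m; last first.
    by rewrite mulr0 nth_default // (leq_trans sz_r).
  rewrite mulrC divpK // dvdp_XsubCl; apply/rootP.
  exact: relation_vanish a_root sz_r r0 j_m.
have r'0 : evxy r' = 0.
  move/eqP: r0; rewrite rE ev_M ev_C evX_XsubC mulf_eq0.
  by rewrite (negPf (subr_const_neq0 _)) => /eqP.
have ri'E : r`_i = ('X - a%:P) * r'`_i by rewrite rE coefCM.
rewrite ri'E (IH r') ?mulr0 // ?size_poly //.
move: ri0 sz_ri; rewrite ri'E mulf_eq0 negb_or => /andP[_ r'i0].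
by rewrite size_monicM ?monicXsubC // size_XsubC.
Qed.

Lemma reduce (p : {poly {poly K}}) : exists g r : {poly {poly K}},
  p = g * ('X^m + ('X^m + 1)%:P) + r /\ (size r <= m)%N.
Proof.
have mon : 'X^m + ('X^m + 1)%:P \is @monic {poly K} by exact: monicXnaddC.
exists (Pdiv.Ring.rdivp p ('X^m + ('X^m + 1)%:P)).
exists (Pdiv.Ring.rmodp p ('X^m + ('X^m + 1)%:P)).
split; first exact: Pdiv.RingMonic.rdivp_eq mon p.
rewrite -ltnS -(size_XnaddC ('X^m + 1 : {poly K}) m_gt0).
by rewrite Pdiv.Ring.ltn_rmodpN0 // monic_neq0.
Qed.

Lemma ev_fermat : evxy ('X^m + ('X^m + 1)%:P) = 0.
Proof.
by rewrite ev_D ev_exp ev_X ev_C evX_D evX_exp evX_X evX_1 fermat_eq addNr.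
Qed.

Lemma ev_reduce p : exists2 r : {poly {poly K}}, evxy p = evxy r & (size r <= m)%N.
Proof.
have [g [r [-> sz_r]]] := reduce p; exists r => //.
by rewrite ev_D ev_M ev_fermat mulr0 add0r.
Qed.

(** By [powers_free] the equation of the curve generates all relations, so the value
    at a point of the curve depends only on the element of [L]. *)
Lemma ev_eq0_evK a b p : a ^+ m + b ^+ m + 1 = 0 -> evxy p = 0 -> evK a b p = 0.
Proof.
move=> ab_curve; have [g [r [-> sz_r]]] := reduce p.
rewrite ev_D ev_M ev_fermat mulr0 add0r => /(powers_free sz_r) ->.
rewrite addr0 evK_M evK_D evK_exp evK_X evK_C hornerD hornerXn hornerC.
by rewrite [b ^+ m + _]addrCA addrA ab_curve mulr0.
Qed.

End FermatField.

(** * The local ring at a point *)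

Definition centered (K L : fieldType) (kappa : {rmorphism K -> L})
    (P : place kappa) (x : L) (a : K) (y : L) (b : K) : Prop :=
  x - kappa a \in max_ideal P /\ y - kappa b \in max_ideal P.

Section Centered.

Variables (K L : fieldType) (kappa : {rmorphism K -> L}) (P : place kappa).
Variables (x y : L).

Lemma evX_vring c : x \in vring P -> evX kappa x c \in vring P.
Proof.
move=> xO; rewrite (evX_coef_wide kappa x (leqnn _)) rpred_sum // => i _.
by rewrite rpredM ?vring_const // rpredX.
Qed.

Lemma ev_vring p : x \in vring P -> y \in vring P -> ev kappa x y p \in vring P.
Proof.
move=> xO yO; rewrite (ev_coef_wide kappa x y (leqnn _)) rpred_sum // => i _.
by rewrite rpredM ?evX_vring // rpredX.
Qed.

Lemma cong_vring a : x - kappa a \in max_ideal P -> x \in vring P.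
Proof.
by move=> xM; rewrite -(subrK (kappa a) x) rpredD ?vring_const // max_ideal_vring.
Qed.

Variables (a b : K).
Hypothesis Pab : centered P x a y b.

Lemma centered_vringl : x \in vring P.
Proof. by case: Pab => /cong_vring. Qed.

Lemma centered_cong p : ev kappa x y p - kappa (evK a b p) \in max_ideal P.
Proof.
have [xM yM] := Pab; have xO := centered_vringl.
have yO : y \in vring P.
  by rewrite -(subrK (kappa b) y) rpredD ?vring_const // max_ideal_vring.
have [p1 [p2 pE]] := taylor1 a b p.
rewrite {1}pE !(ev_B, ev_D, ev_M, ev_C, evX_XsubC, evX_C, ev_X) addrK.
by apply: max_idealD; apply: max_idealMr => //; apply: ev_vring.
Qed.

Lemma centered_vunit p : evK a b p != 0 -> ev kappa x y p \in vunit P.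
Proof. by move=> p0; apply: vunit_cong (centered_cong p) p0. Qed.

Lemma centered_max_ideal p : ev kappa x y p \in max_ideal P -> evK a b p = 0.
Proof.
by move=> pM; apply/eqP/negPn/negP => /centered_vunit; apply/negP/max_idealN_vunit.
Qed.

End Centered.

Section LocalRing.

Variables (K : closedFieldType) (L : fieldType) (kappa : {rmorphism K -> L}).
Variables (m : nat) (x y : L).
Hypotheses (m_gt0 : (0 < m)%N) (m_neq0 : m%:R != 0 :> K).
Hypothesis L_fermat : fermat_function_field kappa m x y.

Variables (a b : K).
Hypotheses (ab_curve : a ^+ m + b ^+ m + 1 = 0) (b_neq0 : b != 0).

Local Notation evx := (evX kappa x).
Local Notation evxy := (ev kappa x y).

(** Where [b] is nonzero the vertical derivative [m b^(m-1)] of the equation is a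
    unit, so [y - b] is a multiple of [x - a]. *)
Lemma local_factor h : evK a b h = 0 -> exists u h' : {poly {poly K}},
  evK a b u != 0 /\ evxy u * evxy h = (x - kappa a) * evxy h'.
Proof.
move=> h0; have [p1 [p2 hE]] := taylor1 a b h.
(* [(y - b) U = - (x - a) W] on the curve, and [U] is [m b^(m-1)] at the point. *)
pose U : {poly {poly K}} := \sum_(i < m) 'X^(m.-1 - i) * b%:P%:P ^+ i.
pose W : {poly K} := \sum_(i < m) 'X^(m.-1 - i) * a%:P ^+ i.
have UE : 'X^m - b%:P%:P ^+ m = ('X - b%:P%:P) * U by exact: subrXX.
have WE : 'X^m - a%:P ^+ m = ('X - a%:P) * W by exact: subrXX.
have evU : (y - kappa b) * evxy U = - ((x - kappa a) * evx W).
  have -> : y - kappa b = evxy ('X - b%:P%:P) by rewrite ev_B ev_X ev_C evX_C.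
  rewrite -evX_XsubC -evX_M -WE -ev_M -UE ev_B !ev_exp ev_X ev_C evX_C.
  rewrite evX_B !evX_exp evX_X evX_C (fermat_eq L_fermat) -!rmorphXn.
  have -> : a ^+ m = - (b ^+ m + 1).
    by apply/eqP; rewrite -addr_eq0 addrA ab_curve.
  by rewrite rmorphN rmorphD rmorph1; ring.
exists U, (p1 * U - p2 * W%:P); split.
  have -> : evK a b U = m%:R * b ^+ m.-1.
    rewrite rmorph_sum /= (eq_bigr (fun=> b ^+ m.-1)) => [|i _].
      by rewrite sumr_const card_ord mulr_natl.
    rewrite evK_M !evK_exp evK_X evK_C hornerC -exprD subnK //.
    by rewrite -ltnS prednK.
  by rewrite mulf_neq0 ?expf_neq0.
rewrite hE h0 !polyC0 addr0 ev_D !ev_M ev_C evX_XsubC !ev_B !ev_M !ev_C ev_X evX_C.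
rewrite mulrDr [X in _ + X]mulrA [evxy U * (y - _)]mulrC.
by rewrite evU; ring.
Qed.

(** Each factor [x - a] split off from [h] cancels against one on the right; once none
    is left there, [h] does not vanish at the point either. *)
Lemma local_order e h s w : evxy h * evxy s = (x - kappa a) ^+ e * evxy w ->
  evK a b w != 0 ->
  exists (n : nat) (p q : {poly {poly K}}), [/\ evK a b p != 0, evK a b q != 0
    & evxy h * evxy q = (x - kappa a) ^+ n * evxy p].
Proof.
elim: e h w => [|e IH] h w hsE w0;
    (have [h0|h0] := eqVneq (evK a b h) 0; last first).
- by exists 0%N, h, 1; rewrite evK_1 oner_neq0 h0 ev_1 mulr1 mul1r.
- case/eqP: w0; apply/esym/eqP; rewrite -subr_eq0.
  have /(ev_eq0_evK m_gt0 m_neq0 L_fermat ab_curve) : evxy (h * s - w) = 0.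
    by rewrite ev_B ev_M hsE mul1r subrr.
  by rewrite evK_B evK_M h0 mul0r sub0r => ->.
- by exists 0%N, h, 1; rewrite evK_1 oner_neq0 h0 ev_1 mulr1 mul1r.
have [u [h' [u0 uhE]]] := local_factor h0.
have xa0 := subr_const_neq0 L_fermat a.
have [||n [p [q [p0 q0 qE]]]] := IH h' (w * u).
- apply: (mulfI xa0); rewrite mulrA -uhE ev_M.
  by rewrite -mulrA hsE exprS; ring.
- by rewrite evK_M mulf_neq0.
exists n.+1, p, (u * q); rewrite evK_M mulf_neq0 //; split=> //.
by rewrite ev_M mulrCA mulrA uhE -mulrA qE exprS; ring.
Qed.

(** [x - a] is a uniformizer: numerator and denominator divide polynomials in [x]
    alone, whose order at [a] is visible. *)
Lemma local_structure (z : L) : z != 0 ->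
  exists (n : int) (p q : {poly {poly K}}), [/\ evK a b p != 0, evK a b q != 0
    & z = evxy p / evxy q * (x - kappa a) ^ n].
Proof.
have xa0 := subr_const_neq0 L_fermat a.
have ev0 p : evK a b p != 0 -> evxy p != 0.
  by apply: contra => /eqP/(ev_eq0_evK m_gt0 m_neq0 L_fermat ab_curve) ->.
have poly_case h : evxy h != 0 -> exists (n : nat) (p q : {poly {poly K}}),
    [/\ evK a b p != 0, evK a b q != 0 & evxy h = evxy p / evxy q * (x - kappa a) ^ n].
  move=> h0; have [N [s [N0 NE]]] := ev_dvd_evx m_gt0 L_fermat h0.
  have [e [N1]] := multiplicity_XsubC N a; rewrite N0 /= => N1a N1E.
  have [||n [p [q [p0 q0 hqE]]]] := @local_order e h s N1%:P.
  - by rewrite -NE N1E evX_M evX_exp evX_XsubC ev_C mulrC.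
  - by rewrite evK_C.
  exists n, p, q; split=> //; apply: (mulIf (ev0 _ q0)).
  by rewrite hqE exprnP mulrAC divfK ?ev0 // mulrC.
move=> z0; have [d [h [d0 zdE]]] := fractionP m_gt0 L_fermat z.
have d0' : evxy d%:P != 0 by rewrite ev_C (evx_neq0 L_fermat).
have h0 : evxy h != 0 by rewrite -zdE mulf_neq0 // -(ev_C kappa x y).
have [n [p [q [p0 q0 hE]]]] := poly_case h h0.
have [n' [p' [q' [p'0 q'0 dE]]]] := poly_case _ d0'.
exists (n%:Z - n'%:Z), (p * q'), (p' * q); rewrite !evK_M !mulf_neq0 //; split=> //.
have -> : z = evxy h / evxy d%:P by rewrite -zdE ev_C mulfK // -(ev_C kappa x y).
rewrite hE dE !ev_M expfzDr // -invr_expz.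
by field; rewrite !ev0 //= expf_neq0.
Qed.

Definition local_ring : {pred L} := [pred z | `[< exists p q : {poly {poly K}},
  evK a b q != 0 /\ z * evxy q = evxy p >]].

Lemma local_ring_valuation : valuation_ring kappa local_ring.
Proof.
have ev0 p : evK a b p != 0 -> evxy p != 0.
  by apply: contra => /eqP/(ev_eq0_evK m_gt0 m_neq0 L_fermat ab_curve) ->.
have xa0 := subr_const_neq0 L_fermat a.
split.
- split=> [|u v /asboolP[p [q [q0 uE]]] /asboolP[p' [q' [q'0 vE]]]
           |u v /asboolP[p [q [q0 uE]]] /asboolP[p' [q' [q'0 vE]]]].
  + by apply/asboolP; exists 1, 1; rewrite evK_1 oner_neq0 mul1r.
  + apply/asboolP; exists (p * q' - p' * q), (q * q').
    rewrite evK_M mulf_neq0 //; split=> //.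
    by rewrite ev_B !ev_M -uE -vE; ring.
  + apply/asboolP; exists (p * p'), (q * q').
    rewrite evK_M mulf_neq0 //; split=> //.
    by rewrite !ev_M -uE -vE; ring.
- move=> c; apply/asboolP; exists c%:P%:P, 1.
  by rewrite evK_1 oner_neq0 ev_1 mulr1 ev_C evX_C.
- exists (x - kappa a)^-1; apply/asboolP => -[p [q [q0 qE]]].
  case/eqP: q0.
  have /(ev_eq0_evK m_gt0 m_neq0 L_fermat ab_curve) : evxy (q - ('X - a%:P)%:P * p) = 0.
    by rewrite ev_B ev_M ev_C evX_XsubC -qE mulVKf ?subrr.
  by rewrite evK_B evK_M evK_C hornerXsubC subrr mul0r subr0.
- move=> z; have [->|z0] := eqVneq z 0.
    by left; apply/asboolP; exists 0, 1; rewrite evK_1 oner_neq0 ev_0 mul0r.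
  have [[n|n] [p [q [p0 q0 ->]]]] := local_structure z0.
    left; apply/asboolP; exists (p * (('X - a%:P)%:P) ^+ n), q; split=> //.
    by rewrite ev_M ev_exp ev_C evX_XsubC mulrAC divfK ?ev0.
  right; apply/asboolP; exists (q * (('X - a%:P)%:P) ^+ n.+1), p; split=> //.
  rewrite ev_M ev_exp ev_C evX_XsubC NegzE -exprnN.
  by field; rewrite !ev0 //= expf_neq0.
Qed.

Lemma exists_centered : exists P : place kappa, centered P x a y b.
Proof.
exists (Place local_ring_valuation).
have maxE p : evK a b p = 0 -> evxy p \in max_ideal (Place local_ring_valuation).
  move=> p0; apply/max_idealP; split.
    by apply/asboolP; exists p, 1; rewrite evK_1 oner_neq0 ev_1 mulr1.
  move=> evp0; apply/asboolP => -[s [q [q0 qE]]]; case/eqP: q0.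
  have /(ev_eq0_evK m_gt0 m_neq0 L_fermat ab_curve) : evxy (q - p * s) = 0.
    by rewrite ev_B ev_M -qE mulVKf ?subrr.
  by rewrite evK_B evK_M p0 mul0r subr0.
split.
  rewrite -evX_XsubC -(ev_C _ _ y); apply: maxE.
  by rewrite evK_C hornerXsubC subrr.
have -> : y - kappa b = evxy ('X - b%:P%:P) by rewrite ev_B ev_X ev_C evX_C.
by apply: maxE; rewrite evK_B evK_X evK_C hornerC subrr.
Qed.

Variables (P : place kappa).
Hypothesis Pab : centered P x a y b.

Lemma centered_decompose z : z != 0 ->
  exists (n : int) (u : L), [/\ u \in vunit P, u \in local_ring, u^-1 \in local_ring
    & z = u * (x - kappa a) ^ n].
Proof.
move=> /local_structure[n [p [q [p0 q0 zE]]]].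
have pU := centered_vunit Pab p0; have qU := centered_vunit Pab q0.
exists n, (evxy p / evxy q); split=> //; first by rewrite vunitM ?vunitV.
  by apply/asboolP; exists p, q; rewrite divfK ?(vunit_neq0 qU).
by apply/asboolP; exists q, p; rewrite invf_div divfK ?(vunit_neq0 pU).
Qed.

Lemma centered_prime : prime_element P (x - kappa a).
Proof.
have xM : x - kappa a \in max_ideal P by case: Pab.
move=> z; split=> [zM|[w wO ->]]; last exact: max_idealMl.
have [->|z0] := eqVneq z 0; first by exists 0; rewrite ?rpred0 ?mul0r.
have [n [u [uU _ _ zE]]] := centered_decompose z0.
case: n zE => [[|n]|n] zE.
- by move: zM (max_idealN_vunit zM); rewrite zE expr0z mulr1 uU.
- exists (u * (x - kappa a) ^+ n); last by rewrite zE -mulrA -exprSr.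
  by rewrite rpredM ?(vunit_vring uU) // rpredX // max_ideal_vring.
have : z * (x - kappa a) ^+ n.+1 \in max_ideal P.
  by rewrite max_idealMr // rpredX // max_ideal_vring.
rewrite zE NegzE -exprnN divfK ?expf_neq0 ?(subr_const_neq0 L_fermat) //.
by move=> /max_idealN_vunit; rewrite uU.
Qed.

Lemma centered_valuation z : z != 0 -> exists n, valuation P z n.
Proof.
move=> /centered_decompose[n [u [uU _ _ zE]]]; exists n, (x - kappa a), u.
by split=> //; apply: centered_prime.
Qed.

Lemma centered_vring : vring P =i local_ring.
Proof.
move=> z; have [->|z0] := eqVneq z 0.
  rewrite rpred0; apply/esym/asboolP.
  by exists 0, 1; rewrite evK_1 oner_neq0 ev_0 mul0r.
apply/idP/idP => [zO|/asboolP[p [q [q0 zqE]]]]; last first.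
  have qU := centered_vunit Pab q0.
  rewrite -[z](mulfK (vunit_neq0 qU)) zqE rpredM //; last first.
    by rewrite vunit_vring // vunitV.
  have [xO yO] : x \in vring P /\ y \in vring P.
    by case: Pab => /cong_vring + /cong_vring.
  exact: ev_vring.
have [n [u [uU /asboolP[p [q [q0 uE]]] _ zE]]] := centered_decompose z0.
have : valuation P z n by exists (x - kappa a), u; split=> //; apply: centered_prime.
move/valuation_vring; rewrite zO => /esym; case: n zE => // n zE _.
apply/asboolP; exists (p * (('X - a%:P)%:P) ^+ n), q; split=> //.
by rewrite zE ev_M ev_exp ev_C evX_XsubC -uE mulrAC.
Qed.

End LocalRing.

(** * Charts of the curve *)

Section Charts.

Variables (K : closedFieldType) (L : fieldType) (kappa : {rmorphism K -> L}).
Variables (m : nat) (m_gt0 : (0 < m)%N) (m_neq0 : m%:R != 0 :> K).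

Lemma algebraic_root (z : L) : algebraicOver kappa (z ^+ m) -> algebraicOver kappa z.
Proof.
case=> p p0 /rootP pz; exists (p \Po 'X^m).
  by rewrite comp_poly_eq0 // size_polyXn.
by apply/rootP; rewrite map_comp_poly map_polyXn horner_comp hornerXn.
Qed.

Lemma fermat_swap x y : fermat_function_field kappa m x y ->
  fermat_function_field kappa m y x.
Proof.
move=> L_fermat; case: (L_fermat) => eq_xy x_tr gen; split.
- by rewrite [y ^+ m + _]addrC.
- move=> y_alg; apply: x_tr; apply: algebraic_root.
  have -> : x ^+ m = - (y ^+ m + 1).
    by apply/eqP; rewrite -addr_eq0 addrA eq_xy.
  apply: algebraic_opp; apply: algebraic_add; last exact: algebraic1.
  by elim: (m) => [|n IH]; [exact: algebraic1 | rewrite exprS; apply: algebraic_mul].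
- by move=> z S Sring Sc Sy Sx; apply: gen.
Qed.

(** The coordinates [(1/x, y/x)] satisfy the same equation, so that the points at
    infinity are affine points of another chart. *)
Lemma fermat_inv x y : fermat_function_field kappa m x y ->
  fermat_function_field kappa m x^-1 (y / x).
Proof.
move=> L_fermat; have x0 := fermat_y_neq0 m_gt0 (fermat_swap L_fermat).
case: (L_fermat) => eq_xy x_tr gen; split.
- rewrite exprMn exprVn (fermat_eq L_fermat); field.
  by rewrite expf_neq0.
- by move=> /algebraic_inv; rewrite invrK.
- move=> z S Sring Sc Sx Sy; have [S1 SB SD] := Sring.
  have Sx' : x \in S by rewrite -[x]invrK -[_^-1]mul1r SD.
  by apply: gen => //; rewrite -[y](divfK x0) -[x in _ * x]invrK SD.
Qed.

End Charts.

Section Places.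

Variables (K : closedFieldType) (L : fieldType) (kappa : {rmorphism K -> L}).
Variables (m : nat) (m_gt0 : (0 < m)%N) (m_neq0 : m%:R != 0 :> K).

Lemma fermat_vring x y (Q : place kappa) : fermat_function_field kappa m x y ->
  x \in vring Q -> y \in vring Q.
Proof.
move=> L_fermat xO; apply: (vring_root m_gt0).
by rewrite (fermat_eq L_fermat) rpredN rpredD ?rpred1 // rpredX.
Qed.

(** If no [x - a] were a non-unit, all of [K(x)] and hence all of [L] would lie in
    the valuation ring. *)
Lemma exists_residue x y (Q : place kappa) : fermat_function_field kappa m x y ->
  x \in vring Q -> exists a, x - kappa a \in max_ideal Q.
Proof.
move=> L_fermat xO; apply: contrapT => no_res.
have xU a : x - kappa a \in vunit Q.
  rewrite vunitE ?rpredB ?vring_const //.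
  by apply/negP => xM; apply: no_res; exists a.
have evU c : c != 0 -> evX kappa x c \in vunit Q.
  have [rs cE] := closed_field_poly_normal c => c0.
  rewrite cE -mul_polyC evX_M evX_C vunitM ?vunit_const ?lead_coef_eq0 // {cE}.
  elim: rs => [|r rs IH]; first by rewrite big_nil evX_1 vunit1.
  by rewrite big_cons evX_M vunitM // evX_XsubC.
case: (vringP Q) => _ _ [z /negP zO] _; apply: zO.
have [d [h [/evU dU zdE]]] := fractionP m_gt0 L_fermat z.
rewrite -[z](mulfK (vunit_neq0 dU)) zdE rpredM //.
  by rewrite ev_vring // (fermat_vring L_fermat).
by rewrite vunit_vring // vunitV.
Qed.

Lemma centered_curve x y (Q : place kappa) a b :
  fermat_function_field kappa m x y -> centered Q x a y b ->
  a ^+ m + b ^+ m + 1 = 0.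
Proof.
move=> L_fermat Qab; have := centered_cong Qab ('X^m + ('X^m + 1)%:P).
rewrite (ev_fermat L_fermat) sub0r evK_D evK_exp evK_X evK_C.
rewrite hornerD hornerXn hornerC => /max_idealN; rewrite opprK => /max_ideal_const.
by rewrite addrA [b ^+ m + _]addrC.
Qed.

Lemma exists_center x y (Q : place kappa) : fermat_function_field kappa m x y ->
  x \in vring Q -> exists a b, centered Q x a y b.
Proof.
move=> L_fermat xO; have yO := fermat_vring L_fermat xO.
have [a aM] := exists_residue L_fermat xO.
by have [b bM] := exists_residue (fermat_swap m_gt0 L_fermat) yO; exists a, b.
Qed.

Lemma centered_swap x y (Q : place kappa) a b :
  centered Q x a y b -> centered Q y b x a.
Proof. by case. Qed.

Lemma exists_center_inv x y (Q : place kappa) : fermat_function_field kappa m x y ->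
  x \notin vring Q -> exists2 b, centered Q x^-1 0 (y / x) b & b ^+ m = -1.
Proof.
move=> L_fermat xO; have xVM := max_idealV xO.
have L_fermat' := fermat_inv m_gt0 L_fermat.
have [a [b Qab]] := exists_center L_fermat' (max_ideal_vring xVM).
have a0 : a = 0.
  case: (Qab) => /(max_idealB xVM); rewrite opprB addrC subrK => + _.
  exact: max_ideal_const.
rewrite a0 in Qab; exists b => //; apply/eqP; rewrite -addr_eq0.
have := centered_curve L_fermat' Qab.
by rewrite expr0n gtn_eqF // add0r => ->.
Qed.

Lemma curve_neq0 (a b : K) : a ^+ m + b ^+ m + 1 = 0 -> b = 0 -> a != 0.
Proof.
move=> ab_curve b0; apply: contra_eq_neq ab_curve => ->.
by rewrite b0 !expr0n gtn_eqF // !add0r oner_neq0.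
Qed.

Lemma root_m1_neq0 (b : K) : b ^+ m = -1 -> b != 0.
Proof.
move=> bE; apply: contra_eq_neq bE => ->.
by rewrite expr0n gtn_eqF // eq_sym oppr_eq0 oner_neq0.
Qed.

(** Each place has an affine center in one of the three charts, with second
    coordinate nonzero, so [centered_valuation] applies. *)
Lemma exists_valuation x y (Q : place kappa) (z : L) :
  fermat_function_field kappa m x y -> z != 0 -> exists n, valuation Q z n.
Proof.
move=> L_fermat z0; have [xO|xO] := boolP (x \in vring Q); last first.
  have [b Qab bE] := exists_center_inv L_fermat xO.
  have L_fermat' := fermat_inv m_gt0 L_fermat.
  have b_curve := centered_curve L_fermat' Qab.
  exact: (centered_valuation m_gt0 m_neq0 L_fermat' b_curve (root_m1_neq0 bE) Qab).
have [a [b Qab]] := exists_center L_fermat xO.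
have ab_curve := centered_curve L_fermat Qab.
have [b0|b0] := eqVneq b 0; last first.
  exact: (centered_valuation m_gt0 m_neq0 L_fermat ab_curve b0 Qab).
have L_fermat' := fermat_swap m_gt0 L_fermat; have Qba := centered_swap Qab.
have ba_curve := centered_curve L_fermat' Qba; have a0 := curve_neq0 ab_curve b0.
exact: (centered_valuation m_gt0 m_neq0 L_fermat' ba_curve a0 Qba).
Qed.

(** [X^m - c] is separable, so [p] has more distinct roots than its degree. *)
Lemma vanish_roots (p : {poly K}) (c : K) : c != 0 -> (size p <= m)%N ->
  (forall r, r ^+ m = c -> p.[r] = 0) -> p = 0.
Proof.
move=> c0 sz_p p_van.
have mon : 'X^m - c%:P \is monic by rewrite monicXnsubC.
have [rs rsE] := closed_field_poly_normal ('X^m - c%:P).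
rewrite (monicP mon) scale1r in rsE.
have rs_uniq : uniq rs.
  rewrite -separable_prod_XsubC -rsE unlock.
  rewrite derivB derivXn derivC subr0 -scaler_nat coprimepZr //.
  apply: coprimep_expr; rewrite coprimepX rootE !hornerE expr0n gtn_eqF //.
  by rewrite add0r oppr_eq0.
have rs_size : size rs = m.
  by apply: succn_inj; rewrite -(size_prod_XsubC rs id) /= -rsE size_XnsubC.
apply: contraTeq sz_p => p0; rewrite -ltnNge -rs_size max_poly_roots //.
apply/allP => r; rewrite -root_prod_XsubC -rsE => /rootP.
by rewrite !hornerE => /eqP; rewrite subr_eq0 => /eqP/p_van/rootP.
Qed.

(** The constant term of [p] lies in the maximal ideal and is therefore 0, and then
    [y] can be cancelled. *)
Lemma vanish_order (Q : place kappa) (y : L) (p : {poly K}) k w : y != 0 ->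
  y \in max_ideal Q -> w \in vring Q -> (size p <= k)%N ->
  (map_poly kappa p).[y] = y ^+ k * w -> p = 0.
Proof.
move=> y0 yM wO; elim: k p => [|k IH] p; first by rewrite size_poly_leq0 => /eqP.
elim/poly_ind: p => // p c _ sz_p.
rewrite rmorphD rmorphM /= map_polyX map_polyC !hornerE exprS => pE.
have p_ring : (map_poly kappa p).[y] \in vring Q.
  by rewrite -evXE evX_vring // max_ideal_vring.
have c0 : c = 0.
  apply: (@max_ideal_const _ _ _ Q).
  have -> : kappa c = y * (y ^+ k * w) - (map_poly kappa p).[y] * y.
    by rewrite mulrA -pE addrC addKr.
  apply: max_idealB; last exact: max_idealMl.
  by apply: max_idealMr => //; rewrite rpredM // rpredX // max_ideal_vring.
rewrite c0 polyC0 addr0 in sz_p *.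
rewrite (IH p) ?mul0r //.
  have [->|p0] := eqVneq p 0; first by rewrite size_poly0.
  by move: sz_p; rewrite size_mulX.
apply: (mulIf y0); rewrite -[LHS]addr0 -[X in _ + X](rmorph0 kappa) -c0 pE.
by ring.
Qed.

(** * Functions without finite poles *)

Section Polynomials.

Variables (x y : L) (L_fermat : fermat_function_field kappa m x y).

(** Over a value [a] with [a^m <> -1] the fibre has [m] points, over the others a
    single point with [y] as uniformizer and [x - a] of order [m]; either way the
    residues determine the polynomial modulo [X - a]. *)
Lemma vanish_fibre a (h : {poly {poly K}}) g d : (size h <= m)%N ->
  (forall Q : place kappa, x \in vring Q -> g \in vring Q) ->
  g * (evX kappa x d * (x - kappa a)) = ev kappa x y h ->
  map_poly (horner_eval a) h = 0.
Proof.
move=> sz_h g_reg gE.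
have sz_p : (size (map_poly (horner_eval a) h) <= m)%N.
  exact: leq_trans (size_poly _ _) sz_h.
have [a_root|a_root] := eqVneq (a ^+ m + 1) 0; last first.
  apply: (@vanish_roots _ (- (a ^+ m + 1))); rewrite ?oppr_eq0 // => b bE.
  have ab_curve : a ^+ m + b ^+ m + 1 = 0 by rewrite bE; ring.
  have b0 : b != 0.
    apply: contra_neq a_root => b0; move/eqP: bE.
    by rewrite b0 expr0n gtn_eqF // eq_sym oppr_eq0 => /eqP.
  have [Q Qab] := exists_centered m_gt0 m_neq0 L_fermat ab_curve b0.
  have xO := centered_vringl Qab.
  have -> : (map_poly (horner_eval a) h).[b] = evK a b h.
    have -> : b = horner_eval a b%:P by rewrite /horner_eval hornerC.
    by rewrite horner_map evKE /horner_eval hornerC.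
  apply: (centered_max_ideal Qab); rewrite -gE.
  apply: max_idealMl (g_reg _ xO) (max_idealMl (evX_vring _ xO) _).
  by case: Qab.
have a0_curve : 0 ^+ m + a ^+ m + 1 = 0 by rewrite expr0n gtn_eqF // add0r.
have a0 : a != 0 by apply: root_m1_neq0; apply/eqP; rewrite -addr_eq0 a_root.
have L_fermat' := fermat_swap m_gt0 L_fermat.
have [Q Q0a] := exists_centered m_gt0 m_neq0 L_fermat' a0_curve a0.
have xO := centered_vringl (centered_swap Q0a); have yO := centered_vringl Q0a.
have [yM xM] := Q0a; rewrite rmorph0 subr0 in yM.
have [e eE ea] := cofactor_root m_gt0 m_neq0 a_root.
have eU : evX kappa x e \in vunit Q.
  rewrite -(ev_C kappa x y); apply: (centered_vunit (centered_swap Q0a)).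
  by rewrite evK_C.
(* So a congruence modulo [x - a] is one modulo [y^m]. *)
have xaE : x - kappa a = y ^+ m * - (evX kappa x e)^-1.
  rewrite (fermat_eq L_fermat) mulrNN.
  have -> : x ^+ m + 1 = (x - kappa a) * evX kappa x e.
    by rewrite -evX_XsubC -evX_M -eE evX_D evX_exp evX_X evX_1.
  by rewrite mulfK // (vunit_neq0 eU).
have eVO : (evX kappa x e)^-1 \in vring Q by rewrite vunit_vring // vunitV.
have resE c : exists2 w, w \in vring Q &
    evX kappa x c - kappa c.[a] = y ^+ m * w.
  have /factor_theorem[c' c'E] : root (c - c.[a]%:P) a.
    by rewrite rootE hornerD hornerN hornerC subrr.
  exists (evX kappa x c' * - (evX kappa x e)^-1).
    by rewrite rpredM ?rpredN ?evX_vring.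
  rewrite -(evX_C kappa x) -evX_B c'E evX_M evX_XsubC xaE; ring.
have [w wO hE] : exists2 w, w \in vring Q &
    ev kappa x y h - (map_poly kappa (map_poly (horner_eval a) h)).[y] = y ^+ m * w.
  rewrite -map_poly_comp (ev_coef_wide _ _ _ sz_h) (@horner_coef_wide _ m); last first.
    exact: leq_trans (size_poly _ _) sz_h.
  rewrite -sumrB; elim/big_ind: _ => [|u v [w wO ->] [w' w'O ->]|i _].
  - by exists 0; rewrite ?rpred0 ?mulr0.
  - by exists (w + w'); rewrite ?rpredD ?mulrDr.
  rewrite coef_map_id0; last by rewrite /= /horner_eval horner0 rmorph0.
  have [w wO wE] := resE h`_i; exists (w * y ^+ i); first by rewrite rpredM ?rpredX.
  by rewrite /= -mulrBl wE mulrA.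
have gO := g_reg Q xO.
apply: (@vanish_order Q y _ m
  (g * evX kappa x d * - (evX kappa x e)^-1 - w)) => //.
- exact: fermat_y_neq0 m_gt0 L_fermat.
- by rewrite rpredB ?rpredM ?rpredN ?evX_vring.
rewrite mulrBr -hE -gE xaE; ring.
Qed.

(** A root [a] of the denominator cancels, since by [vanish_fibre] the numerator is
    divisible by [X - a]. *)
Lemma regular_poly g : (forall Q : place kappa, x \in vring Q -> g \in vring Q) ->
  exists2 h : {poly {poly K}}, g = ev kappa x y h & (size h <= m)%N.
Proof.
move=> g_reg; have [d [h0 [d0 gE]]] := fractionP m_gt0 L_fermat g.
have [h hE sz_h] := ev_reduce m_gt0 L_fermat h0; rewrite {}hE in gE.
have [n sz_d] := ubnP (size d); elim: n d d0 h sz_h gE sz_d => // n IH d d0 h sz_h gE.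
have [/eqP/size_poly1P[c c0 dE] _|/closed_rootP[a /factor_theorem[d' d'E]]] :=
    eqVneq (size d) 1%N.
  exists (h * c^-1%:P%:P); last first.
    by rewrite mulrC mul_polyC (leq_trans (size_scale_leq _ _)).
  move: gE; rewrite dE evX_C ev_M ev_C evX_C => <-.
  by rewrite -mulrA -rmorphM mulfV // rmorph1 mulr1.
have d'0 : d' != 0 by apply: contraNneq d0 => d'0; rewrite d'E d'0 mul0r.
rewrite ltnS d'E size_Mmonic ?monicXsubC // size_XsubC addn2 /= => sz_d'.
have gE' : g * (evX kappa x d' * (x - kappa a)) = ev kappa x y h.
  by rewrite -evX_XsubC -evX_M -d'E.
have h_van := vanish_fibre sz_h g_reg gE'.
pose h' := map_poly (fun c : {poly K} => c %/ ('X - a%:P)) h.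
have h'E : h = ('X - a%:P)%:P * h'.
  apply/polyP => i; rewrite coefCM coef_map_id0 ?div0p // mulrC divpK //.
  rewrite dvdp_XsubCl; apply/rootP.
  move/polyP/(_ i): h_van; rewrite coef_map_id0 ?coef0 //.
  exact: horner0.
apply: (IH d' d'0 h') => //.
  exact: leq_trans (size_poly _ _) sz_h.
apply: (mulIf (subr_const_neq0 L_fermat a)); rewrite -mulrA gE' h'E ev_M ev_C.
by rewrite evX_XsubC mulrC.
Qed.

Lemma lead_cong (Q : place kappa) (c : {poly K}) k : x^-1 \in max_ideal Q ->
  (size c <= k.+1)%N -> evX kappa x c / x ^+ k - kappa c`_k \in max_ideal Q.
Proof.
have x0 : x != 0 := fermat_y_neq0 m_gt0 (fermat_swap m_gt0 L_fermat).
move=> xVM sz_c; rewrite (evX_coef_wide kappa x sz_c) big_ord_recr /=.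
rewrite mulrDl mulfK ?expf_neq0 // addrK mulr_suml; apply: max_ideal_sum => j.
have -> : x ^+ k = x ^+ (k - j) * x ^+ j by rewrite -exprD subnK // ltnW.
rewrite invfM mulrA mulrAC mulfK ?expf_neq0 // -exprVn.
by rewrite max_idealMl ?vring_const // max_idealX // subn_gt0.
Qed.

(** If the degree exceeds [d], the form of top degree vanishes at the [m] points at
    infinity, where its value is that of a polynomial of size at most [m] in [y/x]. *)
Lemma degree_bound d (h : {poly {poly K}}) : (size h <= m)%N ->
  (forall Q : place kappa, x \notin vring Q -> ev kappa x y h / x ^+ d \in vring Q) ->
  forall i, (size (h`_i)%R <= d.+1 - i)%N.
Proof.
have x0 : x != 0 := fermat_y_neq0 m_gt0 (fermat_swap m_gt0 L_fermat).
move=> sz_h h_inf.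
suff bound e : (forall i, size (h`_i)%R <= (d + e).+1 - i)%N ->
    forall i, (size (h`_i)%R <= d.+1 - i)%N.
  apply: (bound (\max_(i < m) size (h`_i)%R + m)%N) => i.
  have [i_m|m_i] := ltnP i m; last first.
    by rewrite nth_default ?size_poly0 // (leq_trans sz_h).
  apply: leq_trans (@leq_bigmax 'I_m (fun i => size (h`_i)%R) (Ordinal i_m)) _.
  by move: (\max_(j < m) _)%N => B; lia.
elim: e => [|e IH]; first by rewrite addn0.
rewrite addnS; set D := (d + e).+1 => sz_hi; apply: IH => i.
pose p := \poly_(i < m) (h`_i)`_(D - i).
have p0 : p = 0.
  apply: (@vanish_roots _ (-1)); rewrite ?oppr_eq0 ?oner_neq0 ?size_poly // => b bE.
  have b_curve : 0 ^+ m + b ^+ m + 1 = 0 by rewrite expr0n gtn_eqF // add0r bE addNr.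
  have [Q [xVM yM]] := exists_centered m_gt0 m_neq0 (fermat_inv m_gt0 L_fermat)
    b_curve (root_m1_neq0 bE).
  rewrite rmorph0 subr0 in xVM.
  have xO : x \notin vring Q.
    by have /max_idealP[_] := xVM; rewrite invrK invr_eq0 => /(_ x0).
  apply: (@max_ideal_const _ _ kappa Q).
  have hM : ev kappa x y h / x ^+ D \in max_ideal Q.
    have -> : x ^+ D = x ^+ d * x ^+ e.+1 by rewrite -exprD addnS.
    by rewrite invfM mulrA max_idealMl ?h_inf // -exprVn max_idealX.
  rewrite -[kappa _](subKr (ev kappa x y h / x ^+ D)) max_idealB //.
  rewrite horner_poly rmorph_sum (ev_coef_wide _ _ _ sz_h) mulr_suml -sumrB.
  apply: max_ideal_sum => j; have [j_D|D_j] := leqP j D; last first.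
    have -> : h`_j = 0.
      apply/eqP; rewrite -size_poly_leq0 (leq_trans (sz_hi j)) //.
      by rewrite leqn0 subn_eq0.
    by rewrite evX_0 coef0 !mul0r rmorph0 subrr max_ideal0.
  have -> : evX kappa x h`_j * y ^+ j / x ^+ D =
      evX kappa x h`_j / x ^+ (D - j) * (y / x) ^+ j.
    have -> : x ^+ D = x ^+ (D - j) * x ^+ j by rewrite -exprD subnK.
    by rewrite exprMn exprVn; field; rewrite !expf_neq0.
  apply: max_ideal_congM; last exact: max_ideal_congX.
  by apply: lead_cong => //; rewrite -subSn.
have := sz_hi i; case: (leqP i D) => [i_D|D_i]; last by lia.
rewrite subSn // leq_eqVlt => /predU1P[sz_i|]; last by rewrite ltnS.
have i_m : (i < m)%N.
  rewrite ltnNge; apply/negP => m_i; move: sz_i.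
  by rewrite nth_default ?size_poly0 // (leq_trans sz_h).
have : p`_i = 0 by rewrite p0 coef0.
rewrite coef_poly i_m => lead0; have hi0 : h`_i != 0 by rewrite -size_poly_gt0 sz_i.
by move: hi0; rewrite -lead_coef_eq0 lead_coefE sz_i /= lead0 eqxx.
Qed.

End Polynomials.

End Places.

(** * The conic of Hermitian tangents *)

(** Heron's form: the product of the four lines [c' u +- d' v +- w], where [c = c'^2],
    [d = d'^2], [X = u^2], [Y = v^2], [Z = w^2] (see [conic_heron]). *)
Definition conic (R : comPzRingType) (c d X Y Z : R) : R :=
  (c * X) ^+ 2 + (d * Y) ^+ 2 + Z ^+ 2
  - 2 * (c * X) * (d * Y) - 2 * (c * X) * Z - 2 * (d * Y) * Z.

Lemma conic_heron (R : comPzRingType) (c d u v w : R) :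
  conic (c ^+ 2) (d ^+ 2) (u ^+ 2) (v ^+ 2) (w ^+ 2) =
  (c * u + d * v + w) * ((c * u - d * v - w) *
  ((c * u + d * v - w) * (c * u - d * v + w))).
Proof. by rewrite /conic; ring. Qed.

(** Expansion of the conic at its point on the curve, in the tangent [s] and another
    line [l] through that point: the only term free of [s] is [l^2]. *)
Lemma conic_tangent (R : comPzRingType) (A B l s c d X Y : R) :
  A + B + 1 = 0 -> c * X = A ^+ 2 + A * l -> d * Y = B ^+ 2 + B * (s - l) ->
  conic c d X Y 1 = l ^+ 2 + (2 * B * l + 4 * A * B) * s + B ^+ 2 * s ^+ 2.
Proof.
move=> AB cX dY; rewrite /conic cX dY.
have -> : B = - (1 + A) by apply/eqP; rewrite -addr_eq0 addrC -AB; apply/eqP; ring.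
ring.
Qed.

Section Hermitian.

Variables (K : closedFieldType) (q m : nat).
Hypotheses (qm : q.+1 = (2 * m)%N) (q_gt1 : (1 < q)%N) (q_pchar : [pchar K].-nat q).

Lemma frobeniusD (R : comNzRingType) (f : {rmorphism K -> R}) (x y : R) :
  (x + y) ^+ q = x ^+ q + y ^+ q.
Proof.
rewrite exprDn_pchar //; apply: sub_in_pnat q_pchar => p _.
exact: rmorph_pchar.
Qed.

Lemma frobeniusN (R : comNzRingType) (f : {rmorphism K -> R}) (x : R) :
  (- x) ^+ q = - x ^+ q.
Proof.
by apply/eqP; rewrite -addr_eq0 -(frobeniusD f) addNr expr0n gtn_eqF // ltnW.
Qed.

Lemma frobeniusB (R : comNzRingType) (f : {rmorphism K -> R}) (x y : R) :
  (x - y) ^+ q = x ^+ q - y ^+ q.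
Proof. by rewrite (frobeniusD f) (frobeniusN f). Qed.

(** [q] vanishes in [K], so that [q + 1 = 2 m] becomes 1 there; in particular 2 and
    [m] are units. *)
Lemma double_m : 2 * m%:R = 1 :> K.
Proof.
rewrite -natrM -qm -natr1; suff -> : q%:R = 0 :> K by rewrite add0r.
have p_char : pdiv q \in [pchar K].
  by apply: (pnatPpi q_pchar); rewrite pi_pdiv.
by apply/eqP; rewrite -(dvdn_pcharf p_char) pdiv_dvd.
Qed.

Lemma two_neq0 : 2 != 0 :> K.
Proof. by apply: contra_eq_neq double_m => ->; rewrite mul0r eq_sym oner_neq0. Qed.

Lemma natm_neq0 : m%:R != 0 :> K.
Proof. by apply: contra_eq_neq double_m => ->; rewrite mulr0 eq_sym oner_neq0. Qed.

(** The squares of [a^m] and [b^m] are the norms of [a] and [b] to the field of [q]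
    elements; as [a^m + b^m = -1], this forces [a^m] itself into that field. *)
Lemma power_m_fixed (a b : K) : a ^+ (q ^ 2) = a -> b ^+ (q ^ 2) = b ->
  a ^+ m + b ^+ m + 1 = 0 -> (a ^+ m) ^+ q = a ^+ m.
Proof.
move=> aq2 bq2 ab_curve.
have sq_fixed (c : K) : c ^+ (q ^ 2) = c -> ((c ^+ m) ^+ q) ^+ 2 = (c ^+ m) ^+ 2.
  move=> cE; rewrite exprAC -[(c ^+ m) ^+ 2]exprM mulnC -qm -exprM mulSn mulnn.
  by rewrite exprD cE -exprSr.
have := sq_fixed _ bq2; have -> : b ^+ m = - (1 + a ^+ m).
  by apply/eqP; rewrite -addr_eq0 addrC -ab_curve; apply/eqP; ring.
rewrite (frobeniusN idfun) (frobeniusD idfun) expr1n !sqrrN => bE.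
apply/eqP; rewrite -subr_eq0 -(mulrI_eq0 _ (mulfI two_neq0)); apply/eqP.
have -> : 2 * (a ^+ m ^+ q - a ^+ m) = (1 + a ^+ m ^+ q) ^+ 2 - (1 + a ^+ m) ^+ 2
    - ((a ^+ m ^+ q) ^+ 2 - (a ^+ m) ^+ 2) by ring.
by rewrite bE (sq_fixed _ aq2) !subrr.
Qed.

Lemma sqrt_fixed (a b al : K) : a ^+ (q ^ 2) = a -> b ^+ (q ^ 2) = b ->
  a ^+ m + b ^+ m + 1 = 0 -> al ^+ 2 = a -> al ^+ (q ^ 2) = al.
Proof.
move=> aq2 bq2 ab_curve alE; have := power_m_fixed aq2 bq2 ab_curve.
have [->|al0] := eqVneq al 0.
  by rewrite expr0n expn_eq0 gtn_eqF // ltnW.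
have -> : a ^+ m = al ^+ q.+1 by rewrite -alE -exprM qm.
rewrite -exprM mulSn mulnn exprD exprSr.
by move/mulfI; apply; rewrite expf_neq0.
Qed.

Section Point.

Variables (al be : K).
Hypotheses (al_fixed : al ^+ (q ^ 2) = al) (be_fixed : be ^+ (q ^ 2) = be).
Hypothesis al_be_curve : al ^+ q.+1 + be ^+ q.+1 + 1 = 0.

(** The tangent at a rational point of the Hermitian curve meets the curve nowhere
    else: on a point of intersection the tangent equation and its [q]-th power make
    the Hermitian form of the difference of the two points vanish along with the
    linear form, and these have no common zero but 0. *)
Lemma hermitian_tangent (u v w : K) : u ^+ q.+1 + v ^+ q.+1 + w ^+ q.+1 = 0 ->
  al ^+ q * u + be ^+ q * v + w = 0 -> u = al * w /\ v = be * w.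
Proof.
move=> uvw tan; pose U := u - al * w; pose V := v - be * w.
have w_lin : al ^+ q * u = - (be ^+ q * v + w).
  by apply/eqP; rewrite -addr_eq0 addrA tan.
have UV : al ^+ q * U = - (be ^+ q * V).
  rewrite /U /V mulrBr w_lin; apply/eqP; rewrite -addr_eq0; apply/eqP.
  transitivity (- w * (al ^+ q.+1 + be ^+ q.+1 + 1)).
    by rewrite !exprSr; ring.
  by rewrite al_be_curve mulr0.
have UVq : al * U ^+ q = - (be * V ^+ q).
  have := congr1 (fun z => z ^+ q) UV.
  by rewrite (frobeniusN idfun) !exprMn -!exprM mulnn al_fixed be_fixed.
have w_linq : al * u ^+ q + be * v ^+ q = - w ^+ q.
  have := congr1 (fun z => z ^+ q) tan.
  rewrite !(frobeniusD idfun) !exprMn -!exprM mulnn al_fixed be_fixed.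
  by rewrite expr0n gtn_eqF ?(ltnW q_gt1) // => /eqP; rewrite addr_eq0 => /eqP.
have UV1 : U ^+ q * U = - (V ^+ q * V).
  apply/eqP; rewrite -addr_eq0 /U /V !(frobeniusB idfun) !exprMn; apply/eqP.
  transitivity ((u ^+ q.+1 + v ^+ q.+1 + w ^+ q.+1)
    + w ^+ q * w * (al ^+ q.+1 + be ^+ q.+1 + 1)
    - w * (al * u ^+ q + be * v ^+ q + w ^+ q)
    - w ^+ q * (al ^+ q * u + be ^+ q * v + w)).
    by rewrite !exprSr; ring.
  by rewrite uvw al_be_curve tan w_linq; ring.
have U0 : U ^+ q * U = 0.
  apply: oppr_inj; rewrite oppr0 -mulN1r.
  have -> : -1 = al ^+ q.+1 + be ^+ q.+1.
    by apply/eqP; rewrite eq_sym -addr_eq0 al_be_curve.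
  rewrite mulrDl; have -> : al ^+ q.+1 * (U ^+ q * U) = (al * U ^+ q) * (al ^+ q * U).
    by rewrite exprS; ring.
  by rewrite UVq UV UV1 exprS; ring.
have V0 : V ^+ q * V = 0 by apply: oppr_inj; rewrite -UV1 U0 oppr0.
by split; apply/eqP; rewrite -subr_eq0; [move/eqP: U0|move/eqP: V0];
  rewrite -exprSr expf_eq0.
Qed.

(** The line among the four that contains a given zero of the conic becomes the
    tangent itself after a change of signs of [v] and [w]. *)
Lemma conic_zero (X Y Z : K) : X ^+ m + Y ^+ m + Z ^+ m = 0 ->
  conic ((al ^+ q) ^+ 2) ((be ^+ q) ^+ 2) X Y Z = 0 ->
  X = al ^+ 2 * Z /\ Y = be ^+ 2 * Z.
Proof.
have [[u <-] [v <-] [w <-]] :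
    [/\ exists u, u ^+ 2 = X, exists v, v ^+ 2 = Y & exists w, w ^+ 2 = Z].
  by split; apply: exists_root.
rewrite -!exprM -qm !exprM => uvw; rewrite conic_heron => /eqP.
have even_q (z : K) : (- z) ^+ q.+1 = z ^+ q.+1 by rewrite qm !exprM sqrrN.
rewrite !mulf_eq0 => /or4P[] /eqP tan.
- by have [-> ->] := hermitian_tangent uvw tan; rewrite !exprMn.
- have [||-> vE] := @hermitian_tangent u (- v) (- w); rewrite ?even_q ?mulrN //.
  by rewrite -(sqrrN v) vE; split; ring.
- have [||-> ->] := @hermitian_tangent u v (- w); rewrite ?even_q //.
  by split; ring.
- have [||-> vE] := @hermitian_tangent u (- v) w; rewrite ?even_q ?mulrN //.
  by rewrite -(sqrrN v) vE; split; ring.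
Qed.

Variables (L : fieldType) (kappa : {rmorphism K -> L}) (x y : L) (P : place kappa).
Hypothesis L_fermat : fermat_function_field kappa m x y.
Hypotheses (al_neq0 : al != 0) (be_neq0 : be != 0).
Hypothesis P_center : centered P x (al ^+ 2) y (be ^+ 2).

Local Notation xi := (x - kappa (al ^+ 2)).

(** In characteristic [p] the power [(x'/ga^2)^(q^2)] is [1] up to order [q^2], so
    [x'^((q^2+1)/2)] over [ga] is a square root of [x'] to that precision. *)
Lemma approx_sqrt (x' : L) (ga : K) : ga ^+ (q ^ 2) = ga -> ga != 0 ->
  x' - kappa (ga ^+ 2) \in max_ideal P ->
  (exists2 w, w \in vring P & x' - kappa (ga ^+ 2) = xi * w) ->
  exists u, u - kappa ga \in max_ideal P /\
    exists2 w, w \in vring P & u ^+ 2 = x' + xi ^+ q.+2 * w.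
Proof.
move=> ga_fixed ga0 x'M [w wO x'E].
have kga0 : kappa ga != 0 by rewrite fmorph_eq0.
have q_odd : odd q by rewrite -[odd q]negbK -oddS qm oddM.
have sq_even : (((q ^ 2).+1)./2 * 2)%N = (q ^ 2).+1.
  by rewrite muln2 halfK /= oddX q_odd subn0.
exists (x' ^+ ((q ^ 2).+1)./2 / kappa ga); split.
  have -> : x' ^+ (q ^ 2).+1./2 / kappa ga - kappa ga =
      (x' ^+ (q ^ 2).+1./2 - kappa (ga ^+ 2)) / kappa ga.
    by rewrite rmorphXn; field.
  rewrite max_idealMr // -?fmorphV ?vring_const //.
  have := max_ideal_congX ((q ^ 2).+1)./2 x'M.
  by rewrite -exprM mulnC sq_even exprSr ga_fixed.
have frob2 : x' ^+ (q ^ 2) = kappa (ga ^+ 2) + xi ^+ (q ^ 2) * w ^+ (q ^ 2).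
  have frob2D (z z' : L) : (z + z') ^+ (q ^ 2) = z ^+ (q ^ 2) + z' ^+ (q ^ 2).
    by rewrite -mulnn !exprM !(frobeniusD kappa).
  rewrite -exprMn -x'E -[in LHS](subrK (kappa (ga ^+ 2)) x') frob2D addrC.
  by rewrite -rmorphXn -exprM mulnC exprM ga_fixed.
have x'O : x' \in vring P by exact: cong_vring x'M.
have xiO : xi \in vring P by apply: max_ideal_vring; case: P_center.
exists (xi ^+ (q ^ 2 - q.+2) * w ^+ (q ^ 2) * x' / kappa (ga ^+ 2)).
  by rewrite !rpredM ?rpredX // -fmorphV vring_const.
have qq : (q.+2 + (q ^ 2 - q.+2) = q ^ 2)%N.
  by rewrite subnKC // expnS expn1; move: q_gt1 q_odd; case: (q) => [|[|[|n]]] //; nia.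
rewrite expr_div_n -exprM sq_even exprSr frob2 -rmorphXn /= -{1}qq exprD.
by field.
Qed.

Lemma power_congruence (n k : nat) (z z' w : L) : z' \in vring P -> w \in vring P ->
  z \in vring P -> z = z' + xi ^+ k * w ->
  exists2 w', w' \in vring P & z ^+ n = z' ^+ n + xi ^+ k * w'.
Proof.
move=> z'O wO zO zE.
exists (w * \sum_(i < n) z ^+ (n.-1 - i) * z' ^+ i).
  by rewrite rpredM // rpred_sum // => i _; rewrite rpredM ?rpredX.
by apply/eqP; rewrite mulrA addrC -subr_eq subrXX zE addrC addKr.
Qed.

Lemma tangent_form_linear (A B u v : L) : A ^+ q.+1 + B ^+ q.+1 + 1 = 0 ->
  A ^+ q * u + B ^+ q * v + 1 = A ^+ q * (u - A) + B ^+ q * (v - B).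
Proof. by move=> AB; rewrite -[RHS]addr0 -AB !exprSr; ring. Qed.

(** With [T] the tangent form at [(u, v)] and [(U, V)] the difference of [(u, v)]
    with the point of contact, [T + T^q] differs from the Hermitian equation by the
    Hermitian form of [(U, V)], while [T] is linear in [(U, V)]: eliminating [V]
    leaves [U^(q+1)] modulo multiples of [T]. *)
Lemma tangent_form_identity (A B u v : L) :
  let T := A ^+ q * u + B ^+ q * v + 1 in let U := u - A in
  A ^+ (q * q) = A -> B ^+ (q * q) = B -> A ^+ q.+1 + B ^+ q.+1 + 1 = 0 ->
  T * (B ^+ q.+1 * (1 + T ^+ q.-1) + T ^+ q - T ^+ q.-1 * A ^+ q * U - A * U ^+ q)
    = U ^+ q.+1 + B ^+ q.+1 * (u ^+ q.+1 + v ^+ q.+1 + 1).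
Proof.
move=> T U Aq Bq AB; pose V := v - B.
have TUV : T = A ^+ q * U + B ^+ q * V by exact: tangent_form_linear.
have TqUV : T ^+ q = A * U ^+ q + B * V ^+ q.
  by rewrite TUV (frobeniusD kappa) !exprMn -!exprM Aq Bq.
have Uq : U ^+ q = u ^+ q - A ^+ q by rewrite /U (frobeniusB kappa).
have Vq : V ^+ q = v ^+ q - B ^+ q by rewrite /V (frobeniusB kappa).
have Tq : T ^+ q = A * u ^+ q + B * v ^+ q + 1.
  by rewrite /T !(frobeniusD kappa) !exprMn -!exprM Aq Bq expr1n.
have Tq1 : T ^+ q = T * T ^+ q.-1 by rewrite -exprS prednK // ltnW.
have -> : u ^+ q.+1 + v ^+ q.+1 + 1 = T + T ^+ q + (U ^+ q * U + V ^+ q * V).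
  by rewrite Tq Uq Vq -[LHS]addr0 -AB /T /U /V !exprSr; ring.
have BV : B ^+ q.+1 * (V ^+ q * V) = (T ^+ q - A * U ^+ q) * (T - A ^+ q * U).
  by rewrite TqUV TUV exprSr; ring.
have -> : B ^+ q.+1 * (T + T ^+ q + (U ^+ q * U + V ^+ q * V)) =
    B ^+ q.+1 * (T + T ^+ q + U ^+ q * U) + B ^+ q.+1 * (V ^+ q * V) by ring.
rewrite BV -[LHS]addr0 -(mul0r (U ^+ q * U)) -AB Tq1 !exprSr; ring.
Qed.

(** At approximate square roots [u], [v] of [x], [y] the Hermitian equation holds to
    order [q + 2], so the tangent form has the order [q + 1] of [U^(q+1)]; the three
    other factors of the conic are units. *)
Lemma conic_order :
  valuation P (conic (kappa ((al ^+ q) ^+ 2)) (kappa ((be ^+ q) ^+ 2)) x y 1) q.+1.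
Proof.
have m_gt0 : (0 < m)%N by move: qm; case: (m).
have curve2 : (al ^+ 2) ^+ m + (be ^+ 2) ^+ m + 1 = 0 by rewrite -!exprM -qm.
have be2_neq0 : be ^+ 2 != 0 by rewrite expf_neq0.
have xi_prime : prime_element P xi.
  exact: (centered_prime m_gt0 natm_neq0 L_fermat curve2 be2_neq0 P_center).
have [xM yM] := P_center.
have xiO := max_ideal_vring xM.
have [w0 w0O yE] : exists2 w, w \in vring P & y - kappa (be ^+ 2) = xi * w.
  by have /xi_prime[w wO ->] := yM; exists w; rewrite // mulrC.
have [u [uM [w1 w1O u2E]]] := approx_sqrt al_fixed al_neq0 xM
  ltac:(by exists 1; rewrite ?rpred1 ?mulr1).
have [v [vM [w2 w2O v2E]]] := approx_sqrt be_fixed be_neq0 yM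
  ltac:(by exists w0).
have uO := cong_vring uM; have vO := cong_vring vM.
have xO := cong_vring xM; have yO := cong_vring yM.
set A := kappa al in uM *; set B := kappa be in vM *.
have AB : A ^+ q.+1 + B ^+ q.+1 + 1 = 0.
  by rewrite /A /B -!rmorphXn -!rmorphD -(rmorph1 kappa) -rmorphD al_be_curve rmorph0.
have Aq : A ^+ (q * q) = A by rewrite /A -rmorphXn mulnn al_fixed.
have Bq : B ^+ (q * q) = B by rewrite /B -rmorphXn mulnn be_fixed.
pose T := A ^+ q * u + B ^+ q * v + 1.
pose U := u - A; pose V := v - B.
have [E1 E1O u2mE] := power_congruence m xO w1O (rpredX 2 uO) u2E.
have [E2 E2O v2mE] := power_congruence m yO w2O (rpredX 2 vO) v2E.
pose E := xi ^+ q.+2 * (E1 + E2).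
have EE : u ^+ q.+1 + v ^+ q.+1 + 1 = E.
  rewrite qm !exprM u2mE v2mE (fermat_eq L_fermat) /E; ring.
have TUV : T = A ^+ q * U + B ^+ q * V by exact: tangent_form_linear.
pose N := B ^+ q.+1 * (1 + T ^+ q.-1) + T ^+ q - T ^+ q.-1 * A ^+ q * U - A * U ^+ q.
have TN : T * N = U ^+ q.+1 + B ^+ q.+1 * E.
  by rewrite -EE; apply: tangent_form_identity.
have AU : A \in vring P by rewrite vring_const.
have BU : B \in vunit P by rewrite vunit_const.
have TM : T \in max_ideal P.
  by rewrite TUV max_idealD // max_idealMl // rpredX // vunit_vring.
have N_unit : N \in vunit P.
  have -> : N = B ^+ q.+1 + (B ^+ q.+1 * T ^+ q.-1 + T ^+ q
      - T ^+ q.-1 * (A ^+ q * U) - A * U ^+ q) by rewrite /N; ring.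
  have TqM : T ^+ q \in max_ideal P by rewrite max_idealX // ltnW.
  have Tq1M : T ^+ q.-1 \in max_ideal P by rewrite max_idealX // -ltnS prednK // ltnW.
  have UqM : U ^+ q \in max_ideal P by rewrite max_idealX // ltnW.
  apply: vunitD; first exact: vunitX.
  apply: max_idealB; last exact: max_idealMl.
  apply: max_idealB; last by rewrite max_idealMr // rpredM ?rpredX // max_ideal_vring.
  by apply: max_idealD => //; apply: max_idealMl => //; rewrite rpredX // vunit_vring.
have xi_val := valuation_prime xi_prime.
have U_val : valuation P U 1.
  have uA : u + A \in vunit P.
    have -> : u + A = kappa (2 * al) + (u - A) by rewrite rmorphM rmorph_nat /A; ring.
    by apply: vunitD => //; rewrite vunit_const // mulf_neq0 // two_neq0.
  have -> : U = (1 + xi ^+ q.+1 * w1) / (u + A) * xi.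
    apply: (mulIf (vunit_neq0 uA)).
    rewrite mulrAC divfK ?(vunit_neq0 uA) // /U.
    transitivity (u ^+ 2 - A ^+ 2); first by ring.
    by rewrite u2E [xi ^+ q.+2]exprS /A rmorphXn /=; ring.
  apply: valuation_unitM xi_val.
  rewrite vunitM ?vunitV // vunitD ?vunit1 // max_idealMr //.
  exact: max_idealX.
have T_val : valuation P T q.+1.
  have -> : T = (U ^+ q.+1 + B ^+ q.+1 * E) / N.
    by rewrite -TN mulfK // (vunit_neq0 N_unit).
  have Uq_val := valuationX q.+1 U_val; rewrite mul1r in Uq_val.
  rewrite mulrC; apply: valuation_unitM; first exact: vunitV.
  apply: valuationD Uq_val _.
  have U0 := valuation_neq0 U_val.
  have xiU : xi / U \in vring P.
    by rewrite (valuation_vring (valuationM xi_val (valuationV U_val))).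
  have -> : B ^+ q.+1 * E / U ^+ q.+1 = B ^+ q.+1 * (xi / U) ^+ q.+1 * (E1 + E2) * xi.
    by rewrite /E exprMn exprVn [xi ^+ q.+2]exprSr; field; rewrite expf_neq0.
  apply: max_idealMl => //.
  by rewrite !(rpredM, rpredD) // rpredX // vunit_vring.
set c := kappa ((al ^+ q) ^+ 2); set d := kappa ((be ^+ q) ^+ 2).
have cE : c = (A ^+ q) ^+ 2 by rewrite /c /A !rmorphXn.
have dE : d = (B ^+ q) ^+ 2 by rewrite /d /B !rmorphXn.
have C_uv : valuation P (conic c d (u ^+ 2) (v ^+ 2) 1) q.+1.
  rewrite -[X in conic _ _ _ _ X](expr1n L 2) cE dE conic_heron -/T.
  rewrite mulrC; apply: valuation_unitM T_val.
  have Aqu : A ^+ q * u - kappa (al ^+ q.+1) \in max_ideal P.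
    by rewrite exprSr max_ideal_congM // /A -rmorphXn subrr max_ideal0.
  have Bqv : B ^+ q * v - kappa (be ^+ q.+1) \in max_ideal P.
    by rewrite exprSr max_ideal_congM // /B -rmorphXn subrr max_ideal0.
  have one_cong : 1 - kappa 1 \in max_ideal P by rewrite rmorph1 subrr max_ideal0.
  have al_be1 : al ^+ q.+1 = - (be ^+ q.+1 + 1).
    by apply/eqP; rewrite -addr_eq0 addrA al_be_curve.
  apply: vunitM; [|apply: vunitM].
  - apply: vunit_cong (max_ideal_congB (max_ideal_congB Aqu Bqv) one_cong) _.
    have -> : al ^+ q.+1 - be ^+ q.+1 - 1 = 2 * al ^+ q.+1 by rewrite al_be1; ring.
    by rewrite mulf_neq0 ?two_neq0 // expf_neq0.
  - apply: vunit_cong (max_ideal_congB (max_ideal_congD Aqu Bqv) one_cong) _.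
    have -> : al ^+ q.+1 + be ^+ q.+1 - 1 = - 2 by rewrite al_be1; ring.
    by rewrite oppr_eq0 two_neq0.
  - apply: vunit_cong (max_ideal_congD (max_ideal_congB Aqu Bqv) one_cong) _.
    have -> : al ^+ q.+1 - be ^+ q.+1 + 1 = - (2 * be ^+ q.+1) by rewrite al_be1; ring.
    by rewrite oppr_eq0 mulf_neq0 ?two_neq0 // expf_neq0.
have [w wO CE] : exists2 w, w \in vring P &
    conic c d x y 1 = conic c d (u ^+ 2) (v ^+ 2) 1 + xi ^+ q.+2 * w.
  have cO : c \in vring P by exact: vring_const.
  have dO : d \in vring P by exact: vring_const.
  pose X2 := x + u ^+ 2; pose Y2 := y + v ^+ 2.
  exists (- (c ^+ 2 * X2 * w1 + d ^+ 2 * Y2 * w2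
    - 2 * c * d * (u ^+ 2 * w2 + y * w1) - 2 * c * w1 - 2 * d * w2)).
    rewrite rpredN; by do ?[exact: rpred_nat | assumption | apply: rpredB
      | apply: rpredD | apply: rpredM | apply: rpredX].
  by rewrite /conic /X2 /Y2 u2E v2E; ring.
rewrite CE; apply: (valuationD C_uv).
have xiC : xi ^+ q.+1 / conic c d (u ^+ 2) (v ^+ 2) 1 \in vring P.
  have := valuationM (valuationX q.+1 xi_val) (valuationV C_uv).
  by rewrite mul1r => /valuation_vring ->; rewrite subrr.
have -> : xi ^+ q.+2 * w / conic c d (u ^+ 2) (v ^+ 2) 1 =
    xi ^+ q.+1 / conic c d (u ^+ 2) (v ^+ 2) 1 * w * xi by rewrite exprSr; ring.
by rewrite max_idealMl // rpredM.
Qed.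

End Point.

End Hermitian.

(** * Expansion in powers of two lines *)

Section Expansion.

Variables (K L : fieldType) (kappa : {rmorphism K -> L}) (P : place kappa).
Variables (l t C : L) (A B : K).
Hypotheses (l_val : valuation P l 1) (t_val : valuation P t 2).
Hypothesis C_eq :
  C = l ^+ 2 + (2 * kappa B * l + 4 * kappa A * kappa B) * t + kappa B ^+ 2 * t ^+ 2.

(** Modulo [C] the square of [l] is a multiple of [t], so that a polynomial of
    degree at most [d] in [l] and [t] reduces to this form, where the orders of the
    monomials are the distinct integers from 0 to [2 d]. *)
Definition expandable (d : nat) (g : L) : Prop := exists (p r : {poly K}) (w : L),
  [/\ (size p <= d.+1)%N, (size r <= d)%N, w \in vring P
    & g = evX kappa t p + l * evX kappa t r + C * w].

Let lO : l \in vring P. Proof. by rewrite (valuation_vring l_val). Qed.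
Let tO : t \in vring P. Proof. by rewrite (valuation_vring t_val). Qed.

Lemma expandable_const d c : expandable d (kappa c).
Proof.
exists c%:P, 0, 0; rewrite size_poly0 rpred0 evX_C evX_0 mulr0 mulr0 !addr0.
by split=> //; rewrite (leq_trans (size_polyC_leq1 _)).
Qed.

Lemma expandableD d g g' : expandable d g -> expandable d g' -> expandable d (g + g').
Proof.
move=> [p [r [w [sz_p sz_r wO ->]]]] [p' [r' [w' [sz_p' sz_r' w'O ->]]]].
exists (p + p'), (r + r'), (w + w'); rewrite rpredD //; split=> //.
- by rewrite (leq_trans (size_polyD _ _)) // geq_max sz_p.
- by rewrite (leq_trans (size_polyD _ _)) // geq_max sz_r.
by rewrite !evX_D; ring.
Qed.

Lemma expandable_sum d (I : Type) (s : seq I) (F : I -> L) :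
  (forall i, expandable d (F i)) -> expandable d (\sum_(i <- s) F i).
Proof.
move=> FE; elim/big_ind: _ => [|u v|//]; last exact: expandableD.
by rewrite -(rmorph0 kappa); apply: expandable_const.
Qed.

Lemma expandableZ d c g : expandable d g -> expandable d (kappa c * g).
Proof.
move=> [p [r [w [sz_p sz_r wO ->]]]].
exists (c%:P * p), (c%:P * r), (kappa c * w).
rewrite rpredM ?vring_const // !evX_M !evX_C !mul_polyC; split=> //.
- exact: leq_trans (size_scale_leq _ _) sz_p.
- exact: leq_trans (size_scale_leq _ _) sz_r.
by ring.
Qed.

Lemma expandableS d g : expandable d g -> expandable d.+1 g.
Proof.
by move=> [p [r [w [sz_p sz_r wO gE]]]]; exists p, r, w; split=> //; apply: leqW.
Qed.

Lemma expandable_leq d e g : (d <= e)%N -> expandable d g -> expandable e g.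
Proof.
move=> /subnK <- gE; elim: (e - d)%N => // k IH; exact: expandableS.
Qed.

Lemma size_mulX_leq (p : {poly K}) n : (size p <= n)%N -> (size (p * 'X)%R <= n.+1)%N.
Proof.
by move=> sz_p; have [->|p0] := eqVneq p 0; rewrite ?mul0r ?size_poly0 ?size_mulX.
Qed.

Lemma expandable_mult d g : expandable d g -> expandable d.+1 (t * g).
Proof.
move=> [p [r [w [sz_p sz_r wO ->]]]]; exists (p * 'X), (r * 'X), (t * w).
rewrite rpredM // !size_mulX_leq // !evX_M evX_X; split=> //; ring.
Qed.

Lemma expandable_mull d g : expandable d g -> expandable d.+1 (l * g).
Proof.
move=> [p [r [w [sz_p sz_r wO ->]]]].
exists (- (4 * A * B)%:P * (r * 'X) - (B ^+ 2)%:P * (r * 'X * 'X)),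
  (p - (2 * B)%:P * (r * 'X)), (evX kappa t r + l * w); split.
- rewrite (leq_trans (size_polyD _ _)) // geq_max -polyCN !size_polyN !mul_polyC.
  rewrite !(leq_trans (size_scale_leq _ _)) // !size_mulX_leq //.
  by rewrite leqW // size_mulX_leq.
- rewrite (leq_trans (size_polyD _ _)) // geq_max size_polyN mul_polyC.
  by rewrite sz_p (leq_trans (size_scale_leq _ _)) // size_mulX_leq.
- by rewrite rpredD ?evX_vring ?rpredM.
rewrite -polyCN !(evX_B, evX_M, evX_C, evX_X) C_eq !rmorphN !rmorphM !rmorph_nat.
ring.
Qed.

(** The terms of [p(t)] have even order at [P] and those of [l r(t)] odd order, so
    that nothing cancels; the coefficients vanish one by one, lowest order first. *)
Lemma expandable_order d (p r : {poly K}) w : w \in vring P ->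
  (size p <= d.+1)%N -> (size r <= d)%N ->
  evX kappa t p + l * evX kappa t r = l ^+ (2 * d).+1 * w -> p = 0 /\ r = 0.
Proof.
move=> wO; have l0 := valuation_neq0 l_val; have t0 := valuation_neq0 t_val.
have lM := valuation_max_ideal l_val isT.
have tM := valuation_max_ideal t_val isT.
have tl : t / l ^+ 2 \in vunit P.
  apply: valuation0_vunit.
  by have := valuationM t_val (valuationV (valuationX 2 l_val)).
elim: d p r w wO => [|d IH] p r w wO sz_p sz_r.
  move: sz_r; rewrite size_poly_leq0 => /eqP ->.
  have /size1_polyC -> := sz_p; rewrite evX_C evX_0 mulr0 addr0 expr1 => pE.
  split=> //; congr (_%:P); apply: (@max_ideal_const _ _ kappa P).
  by rewrite pE max_idealMr.
have drop_size (f : {poly K}) c n :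
    (size (f * 'X + c%:P)%R <= n.+1)%N -> (size f <= n)%N.
  by rewrite size_MXaddC; case: ifP => [/andP[/eqP -> _] _|_ //]; rewrite size_poly0.
have [p' [c pE]] := poly_split p; have [r' [e rE]] := poly_split r.
rewrite pE rE in sz_p sz_r *; have sz_p' := drop_size _ _ _ sz_p.
have sz_r' := drop_size _ _ _ sz_r.
rewrite !evX_D !evX_M !evX_X !evX_C => prE.
have p'O := evX_vring p' tO; have r'O := evX_vring r' tO.
have c0 : c = 0.
  apply: (@max_ideal_const _ _ kappa P).
  have -> : kappa c = l ^+ (2 * d.+1).+1 * w
      - l * (evX kappa t r' * t + kappa e) - evX kappa t p' * t by rewrite -prE; ring.
  apply: max_idealB; last exact: max_idealMl.
  apply: max_idealB; first by rewrite max_idealMr // max_idealX.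
  by rewrite max_idealMr // rpredD ?rpredM ?vring_const.
have expE : l ^+ (2 * d.+1).+1 = l ^+ (2 * d).+1 * l ^+ 2.
  by rewrite -exprD; congr (_ ^+ _); lia.
rewrite c0 rmorph0 addr0 expE in prE.
have e0 : e = 0.
  apply: (@max_ideal_const _ _ kappa P).
  have -> : kappa e = l ^+ (2 * d).+1 * l * w - evX kappa t p' * (t / l ^+ 2) * l
      - evX kappa t r' * t.
    apply: (mulfI l0).
    transitivity (l ^+ (2 * d).+1 * l ^+ 2 * w - evX kappa t p' * t
      - l * evX kappa t r' * t).
      by rewrite -prE; ring.
    by field.
  apply: max_idealB; last exact: max_idealMl.
  apply: max_idealB; first by rewrite max_idealMr // max_idealMl // rpredX.
  by rewrite max_idealMl // rpredM // vunit_vring.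
rewrite e0 rmorph0 addr0 in prE.
have [||->->] := IH p' r' (w / (t / l ^+ 2)) _ sz_p' sz_r'.
- by rewrite rpredM // vunit_vring // vunitV.
- apply: (mulIf t0); rewrite [LHS]mulrDl -[l * _ * t]mulrA prE.
  by field; rewrite t0 l0.
by rewrite c0 e0 !mul0r !addr0.
Qed.

End Expansion.

(** * Pole numbers and gaps at a rational point *)

Lemma ev_conic (K L : fieldType) (kappa : {rmorphism K -> L}) x y
    (c d X Y Z : {poly {poly K}}) : ev kappa x y (conic c d X Y Z) =
  conic (ev kappa x y c) (ev kappa x y d) (ev kappa x y X) (ev kappa x y Y)
    (ev kappa x y Z).
Proof.
have ev2 : ev kappa x y 2 = 2 by rewrite ev_D ev_1.
by rewrite /conic !ev_B !ev_D !ev_exp !ev_M ev2.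
Qed.

Lemma evK_conic (K : fieldType) (a b : K) (c d X Y Z : {poly {poly K}}) :
  evK a b (conic c d X Y Z) =
  conic (evK a b c) (evK a b d) (evK a b X) (evK a b Y) (evK a b Z).
Proof.
have evK2 : evK a b 2 = 2 by rewrite evK_D evK_1.
by rewrite /conic !evK_B !evK_D !evK_exp !evK_M evK2.
Qed.

Section Gaps.

Variables (q m : nat) (K : closedFieldType) (L : fieldType).
Variables (kappa : {rmorphism K -> L}) (x y : L) (P : place kappa) (a b : K).
Hypotheses (qm : q.+1 = (2 * m)%N) (q_gt1 : (1 < q)%N) (q_pchar : [pchar K].-nat q).
Hypothesis L_fermat : fermat_function_field kappa m x y.
Hypotheses (aq2 : a ^+ (q ^ 2) = a) (bq2 : b ^+ (q ^ 2) = b).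
Hypotheses (a_neq0 : a != 0) (b_neq0 : b != 0).
Hypothesis P_center : centered P x a y b.

Let m_gt0 : (0 < m)%N. Proof. by move: qm; case: (m). Qed.
Let m_neq0 : m%:R != 0 :> K. Proof. exact: natm_neq0 qm q_gt1 q_pchar. Qed.
Let ab_curve : a ^+ m + b ^+ m + 1 = 0.
Proof. exact: centered_curve L_fermat P_center. Qed.

Let qE : q = (m + m.-1)%N. Proof. by move: qm m_gt0; lia. Qed.

(* Scaled so that [t] is the linear part of the equation at [P], divided by [m]. *)
Local Notation l := (kappa (a ^+ m.-1) * (x - kappa a)).
Local Notation t := (l + kappa (b ^+ m.-1) * (y - kappa b)).
Local Notation C := (conic (kappa (a ^+ q)) (kappa (b ^+ q)) x y 1).

Lemma exists_hermitian_lift : exists al be : K,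
  [/\ al ^+ 2 = a, be ^+ 2 = b, al ^+ (q ^ 2) = al, be ^+ (q ^ 2) = be
    & al ^+ q.+1 + be ^+ q.+1 + 1 = 0].
Proof.
have [al alE] := exists_root (isT : (0 < 2)%N) a.
have [be beE] := exists_root (isT : (0 < 2)%N) b.
have ba_curve : b ^+ m + a ^+ m + 1 = 0 by rewrite [b ^+ m + _]addrC.
exists al, be; split=> //.
- exact: (sqrt_fixed qm q_gt1 q_pchar aq2 bq2 ab_curve alE).
- exact: (sqrt_fixed qm q_gt1 q_pchar bq2 aq2 ba_curve beE).
by rewrite qm !exprM alE beE.
Qed.

Lemma conic_valuation : valuation P C q.+1.
Proof.
have [al [be [alE beE al_f be_f curve]]] := exists_hermitian_lift.
have al0 : al != 0 by apply: contraNneq a_neq0 => al0; rewrite -alE al0 expr0n.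
have be0 : be != 0 by apply: contraNneq b_neq0 => be0; rewrite -beE be0 expr0n.
have := P_center; rewrite -alE -beE => Pc.
rewrite [_ ^+ 2 ^+ q]exprAC [be ^+ 2 ^+ q]exprAC.
exact: (conic_order qm q_gt1 q_pchar al_f be_f curve L_fermat al0 be0 Pc).
Qed.

Lemma conic_zero_center (X Y Z : K) : X ^+ m + Y ^+ m + Z ^+ m = 0 ->
  conic (a ^+ q) (b ^+ q) X Y Z = 0 -> X = a * Z /\ Y = b * Z.
Proof.
have [al [be [alE beE al_f be_f curve]]] := exists_hermitian_lift.
rewrite -alE -beE [_ ^+ 2 ^+ q]exprAC [be ^+ 2 ^+ q]exprAC.
exact: (conic_zero qm q_gt1 q_pchar al_f be_f curve).
Qed.

(** The ring of a place is the local ring of its center. *)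
Lemma center_inj (Q : place kappa) : centered Q x a y b -> Q = P.
Proof.
move=> Q_center; apply/eq_place => z.
rewrite (centered_vring m_gt0 m_neq0 L_fermat ab_curve b_neq0 Q_center).
by rewrite (centered_vring m_gt0 m_neq0 L_fermat ab_curve b_neq0 P_center).
Qed.

Lemma conic_vunit (Q : place kappa) : x \in vring Q -> Q <> P -> C \in vunit Q.
Proof.
move=> xO Q_neq_P; have [a' [b' Q_center]] := exists_center m_gt0 L_fermat xO.
have CE : C = ev kappa x y
    (conic (a ^+ q)%:P%:P (b ^+ q)%:P%:P 'X%:P 'X 1%:P%:P).
  by rewrite ev_conic !ev_C !evX_C evX_X ev_X rmorph1.
rewrite CE; apply: (centered_vunit Q_center); rewrite evK_conic.
rewrite !evK_C !hornerC hornerX evK_X; apply/eqP => C0.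
have a'b' := centered_curve L_fermat Q_center.
have [|] := conic_zero_center _ C0; first by rewrite expr1n.
rewrite !mulr1 => a'E b'E; apply/Q_neq_P/center_inj.
by rewrite -a'E -b'E.
Qed.

Lemma conic_vunit_inf (Q : place kappa) : x \notin vring Q -> C / x ^+ 2 \in vunit Q.
Proof.
move=> xO; have x0 : x != 0 by apply: contraNneq xO => ->; exact: rpred0.
have [b' Q_center b'E] := exists_center_inv m_gt0 L_fermat xO.
have CE : C / x ^+ 2 = ev kappa x^-1 (y / x)
    (conic (a ^+ q)%:P%:P (b ^+ q)%:P%:P 1%:P%:P 'X 'X%:P).
  rewrite ev_conic !ev_C !evX_C evX_X ev_X rmorph1 /conic.
  by field.
rewrite CE; apply: (centered_vunit Q_center); rewrite evK_conic.
rewrite !evK_C !hornerC hornerX evK_X; apply/eqP => C0.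
have [|/eqP] := conic_zero_center _ C0.
  by rewrite b'E expr1n expr0n gtn_eqF // addr0 subrr.
by rewrite mulr0 oner_eq0.
Qed.

Let xi_prime : prime_element P (x - kappa a).
Proof. exact: (centered_prime m_gt0 m_neq0 L_fermat ab_curve b_neq0 P_center). Qed.

Lemma secant_valuation : valuation P l 1.
Proof.
apply: valuation_unitM (valuation_prime xi_prime).
by rewrite vunit_const // expf_neq0.
Qed.

Lemma conic_expand : C = l ^+ 2
  + (2 * kappa (b ^+ m) * l + 4 * kappa (a ^+ m) * kappa (b ^+ m)) * t
  + kappa (b ^+ m) ^+ 2 * t ^+ 2.
Proof.
have pow (c : K) : c ^+ q = c ^+ m * c ^+ m.-1 by rewrite {1}qE exprD.
have powm (c : K) : c ^+ m = c ^+ m.-1 * c by rewrite -exprSr prednK.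
apply: conic_tangent.
- by rewrite -!rmorphD -(rmorph1 kappa) -rmorphD ab_curve rmorph0.
- rewrite pow rmorphM /=; have -> : kappa (a ^+ m) ^+ 2 =
    kappa (a ^+ m) * (kappa (a ^+ m.-1) * kappa a) by rewrite -rmorphM -powm.
  ring.
- rewrite pow rmorphM /=; have -> : kappa (b ^+ m) ^+ 2 =
    kappa (b ^+ m) * (kappa (b ^+ m.-1) * kappa b) by rewrite -rmorphM -powm.
  ring.
Qed.

(** The conic has contact [q + 1 > 2] with the curve, and its expansion expresses
    the tangent [t] through [l ^+ 2]. *)
Lemma tangent_valuation : valuation P t 2.
Proof.
have l_val := secant_valuation; have C_val := conic_valuation.
have lM := valuation_max_ideal l_val isT.
have tM : t \in max_ideal P.
  by have [_ yM] := P_center; rewrite max_idealD // max_idealMl // vring_const.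
set A := kappa (a ^+ m); set B := kappa (b ^+ m).
pose N := 4 * A * B + (2 * B * l + B ^+ 2 * t).
have AU : A \in vunit P by rewrite vunit_const // expf_neq0.
have BU : B \in vunit P by rewrite vunit_const // expf_neq0.
have N_unit : N \in vunit P.
  apply: vunitD.
    rewrite !vunitM // -(rmorph_nat kappa) vunit_const //.
    by rewrite (natrM _ 2 2) mulf_neq0 // (two_neq0 qm q_gt1 q_pchar).
  have BO := vunit_vring BU.
  by rewrite max_idealD // max_idealMl // ?rpredX // rpredM // rpred_nat.
have -> : t = N^-1 * (- l ^+ 2 + C).
  apply: (mulfI (vunit_neq0 N_unit)); rewrite mulVKf ?(vunit_neq0 N_unit) //.
  by rewrite conic_expand /N -/A -/B; ring.
apply: valuation_unitM; first exact: vunitV.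
have l2_val := valuationX 2 l_val; rewrite mul1r in l2_val.
have l2N_val : valuation P (- l ^+ 2) 2.
  rewrite -mulN1r; apply: valuation_unitM => //.
  by rewrite -(rmorphN1 kappa) vunit_const // oppr_eq0 oner_neq0.
apply: (valuationD l2N_val).
apply: valuation_max_ideal (valuationM C_val (valuationV l2N_val)) _.
by rewrite subr_gt0; move: q_gt1 => /=; lia.
Qed.

(** [x] and [y] are affine combinations of [l] and [t]. *)
Lemma plane_expandable d (h : {poly {poly K}}) :
  (forall i, (size (h`_i)%R <= d.+1 - i)%N) ->
  expandable P l t C d (ev kappa x y h).
Proof.
move=> sz_h.
have l_val := secant_valuation; have t_val := tangent_valuation.
have C_eq := conic_expand.
have ka0 : kappa (a ^+ m.-1) != 0 by rewrite fmorph_eq0 expf_neq0.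
have kb0 : kappa (b ^+ m.-1) != 0 by rewrite fmorph_eq0 expf_neq0.
have xE : x = kappa a + kappa (a ^+ m.-1)^-1 * l.
  by rewrite fmorphV mulKf //; ring.
have yE : y = kappa b + kappa (b ^+ m.-1)^-1 * (t + kappa (-1) * l).
  by rewrite fmorphV rmorphN1; apply: (mulfI kb0); rewrite mulrDr mulVKf //; ring.
have expandX e g : expandable P l t C e g -> expandable P l t C e.+1 (x * g).
  move=> ge; rewrite [x in x * g]xE mulrDl -mulrA; apply: expandableD.
    exact/expandableZ/expandableS.
  exact/expandableZ/(expandable_mull l_val t_val C_eq).
have expandY e g : expandable P l t C e g -> expandable P l t C e.+1 (y * g).
  move=> ge; rewrite [y in y * g]yE mulrDl -mulrA mulrDl -[kappa (-1) * _ * _]mulrA.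
  apply: expandableD; first exact/expandableZ/expandableS.
  apply/expandableZ/expandableD; first exact: (expandable_mult t_val).
  exact/expandableZ/(expandable_mull l_val t_val C_eq).
have expandXn n e g :
    expandable P l t C e g -> expandable P l t C (n + e) (x ^+ n * g).
  move=> ge; elim: n => [|n IH]; rewrite ?mul1r // exprS -mulrA addSn.
  exact: expandX.
have expandYn n e g :
    expandable P l t C e g -> expandable P l t C (n + e) (y ^+ n * g).
  move=> ge; elim: n => [|n IH]; rewrite ?mul1r // exprS -mulrA addSn.
  exact: expandY.
rewrite (ev_coef_wide kappa x y (leqnn _)); apply: expandable_sum => i.
rewrite (evX_coef_wide kappa x (sz_h i)) mulr_suml; apply: expandable_sum => j.
rewrite -mulrA; apply: expandableZ; rewrite -[y ^+ i]mulr1.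
apply: (@expandable_leq _ _ _ _ _ _ _ (j + (i + 0))).
  by have := ltn_ord j; lia.
apply: expandXn; apply: expandYn; rewrite -(rmorph1 kappa); exact: expandable_const.
Qed.

Lemma mult_placeE n (Q : place kappa) : Q <> P -> mult_place n P Q = 0.
Proof. by move=> QP; rewrite /mult_place; case: asboolP. Qed.

Lemma mult_place_id n : mult_place n P P = n%:Z.
Proof. by rewrite /mult_place; case: asboolP. Qed.

(** Clearing the poles of [f] with a power of the conic gives a polynomial of degree
    [2 k + 2], whose order at [P] would fall in the interval that orders of reduced
    forms cannot reach. *)
Lemma gap_of_exponents i j k : (i + j + 2 * k + 3 <= m)%N ->
  gaps P (i + 2 * j + k * q.+1 + 1)%N.
Proof.
move=> ijk; set n := (_ + 1)%N => -[f f_pole].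
have l_val := secant_valuation; have t_val := tangent_valuation.
have C_val := conic_valuation; have C0 := valuation_neq0 C_val.
have f_val : valuation P f (- n%:Z).
  have [e fe] := f_pole P; rewrite mult_place_id => nE.
  by have <- : e = - n%:Z by move: nE; rewrite /n; lia.
have f_reg (Q : place kappa) : Q <> P -> f \in vring Q.
  move=> QP; have [e fe] := f_pole Q; rewrite (mult_placeE _ QP) => eE.
  by rewrite (valuation_vring fe); move: eE; lia.
pose g := f * C ^+ k.+1.
have g_val : valuation P g (- n%:Z + q.+1%:Z * k.+1%:Z).
  exact: valuationM f_val (valuationX _ C_val).
(* The order of [g] at [P] is at least [2 d + 1] for [d = 2 (k + 1)]. *)
have n_le : (n + 2 * (2 * k.+1) + 1 <= q.+1 * k.+1)%N by rewrite /n qm; nia.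
have gP : g \in vring P by rewrite (valuation_vring g_val); move: n_le; lia.
have [|h gE sz_h] := @regular_poly _ _ _ _ m_gt0 m_neq0 _ _ L_fermat g.
  move=> Q xO; have [->//|QP] := pselect (Q = P).
  by rewrite rpredM ?f_reg // rpredX // vunit_vring // conic_vunit.
have h_deg := @degree_bound _ _ _ _ m_gt0 m_neq0 _ _ L_fermat (2 * k.+1) h sz_h _.
have /plane_expandable[p [r [w [sz_p sz_r wO gE']]]] :
    forall i, (size (h`_i)%R <= (2 * k.+1).+1 - i)%N.
  apply: h_deg => Q xO; rewrite -gE /g exprM -mulrA -expr_div_n.
  rewrite rpredM ?rpredX ?(vunit_vring (conic_vunit_inf _)) //.
  by apply: f_reg => QP; move: xO; rewrite QP (centered_vringl P_center).
pose d := (2 * k.+1)%N.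
have lC_val := valuationV (valuationX (2 * d).+1 l_val).
have gl : g / l ^+ (2 * d).+1 \in vring P.
  rewrite (valuation_vring (valuationM g_val lC_val)).
  by move: n_le; rewrite /d; lia.
have Cl : C / l ^+ (2 * d).+1 \in vring P.
  rewrite (valuation_vring (valuationM C_val lC_val)).
  by move: ijk; rewrite /d qm; lia.
have [p0 r0] : p = 0 /\ r = 0.
  apply: (@expandable_order _ _ _ P l t l_val t_val d p r
    (g / l ^+ (2 * d).+1 - C / l ^+ (2 * d).+1 * w)) => //.
    by apply: rpredB; [exact: gl | apply: rpredM].
  have l0 := valuation_neq0 l_val.
  have -> : evX kappa t p + l * evX kappa t r = g - C * w by rewrite gE gE'; ring.
  rewrite mulrBr mulrCA divff ?expf_neq0 // mulr1.
  by rewrite mulrA mulrCA divff ?expf_neq0 // mulr1.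
have : g / C \in vring P.
  by rewrite gE gE' p0 r0 !evX_0 mulr0 !add0r mulrAC divff // mul1r.
rewrite (valuation_vring (valuationM g_val (valuationV C_val))).
by rewrite /n qm; nia.
Qed.

(** The function [l^i t^j / C^k]: away from infinity the conic is a unit except at
    [P], and at infinity [C / x^2] is a unit while [l / x] and [t / x] are regular. *)
Lemma nongap_of_exponents i j k n : (i + j <= 2 * k)%N ->
  (n + i + 2 * j = k * q.+1)%N -> weierstrass_semigroup P n.
Proof.
move=> ij nE; have l_val := secant_valuation; have t_val := tangent_valuation.
have C_val := conic_valuation; have C0 := valuation_neq0 C_val.
pose f := l ^+ i * t ^+ j / C ^+ k.
have f_val : valuation P f (- n%:Z).
  have -> : - n%:Z = 1 * i%:Z + 2 * j%:Z - q.+1%:Z * k%:Z by move: nE; lia.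
  apply: valuationM; last exact/valuationV/valuationX.
  by apply: valuationM; apply: valuationX.
have f0 := valuation_neq0 f_val.
exists f => Q; have [->|QP] := pselect (Q = P).
  by exists (- n%:Z); rewrite // mult_place_id; lia.
have [e fe] := exists_valuation m_gt0 m_neq0 Q L_fermat f0.
exists e => //; rewrite (mult_placeE _ QP).
suff : f \in vring Q by rewrite (valuation_vring fe); lia.
have [xO|xO] := boolP (x \in vring Q).
  have yO := fermat_vring m_gt0 L_fermat xO.
  have lO : l \in vring Q by rewrite rpredM ?rpredB ?vring_const.
  have tO : t \in vring Q by rewrite rpredD // rpredM ?rpredB ?vring_const.
  by rewrite !rpredM ?rpredX // -exprVn rpredX // vunit_vring // vunitV // conic_vunit.
have [b' [xVM yxM] _] := exists_center_inv m_gt0 L_fermat xO.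
have xVO := cong_vring xVM; have yxO := cong_vring yxM.
have x0 : x != 0 by apply: contraNneq xO => ->; exact: rpred0.
have lO : l / x \in vring Q.
  have -> : l / x = kappa (a ^+ m.-1) * (1 - kappa a * x^-1) by field.
  by rewrite rpredM ?rpredB ?rpredM ?vring_const ?rpred1.
have tO : t / x \in vring Q.
  have -> : t / x = l / x + kappa (b ^+ m.-1) * (y / x - kappa b * x^-1) by field.
  apply: rpredD => //; apply: rpredM; first exact: vring_const.
  by apply: rpredB => //; rewrite rpredM ?vring_const.
have CU := conic_vunit_inf xO.
have -> : f = (l / x) ^+ i * (t / x) ^+ j * x^-1 ^+ (2 * k - (i + j))
    * (C / x ^+ 2)^-1 ^+ k.
  rewrite /f !expr_div_n !exprVn !expr_div_n -exprM.
  have -> : x ^+ (2 * k) = x ^+ (2 * k - (i + j)) * x ^+ i * x ^+ j.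
    by rewrite -mulrA -!exprD subnK.
  by move: (conic _ _ _ _ _) C0 => c c0; field; rewrite !expf_neq0.
by rewrite !rpredM ?rpredX // vunit_vring // vunitV.
Qed.

End Gaps.

Lemma pnat_pchar (F : finFieldType) (K : fieldType) (iota : {rmorphism F -> K}) q :
  prime_power q -> #|F| = (q ^ 2)%N -> [pchar K].-nat q.
Proof.
move=> [p [k [p_pr k_gt0 ->]]] cardF.
have p_char : p \in [pchar F].
  by apply: card_finPcharP p_pr; rewrite cardF -expnM.
by rewrite pnatX pnatE // (rmorph_pchar iota).
Qed.

(** With [n = k (q + 1) + r] and [r > 0], the number [n] is [(k + 1)(q + 1) - s] for
    [s = q + 1 - r]; it is a pole number when [s <= 4 (k + 1)], and otherwise [r] is
    small enough for the second form. *)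
Lemma gap_arith (m q n : nat) : q.+1 = (2 * m)%N ->
  (exists i j k, (i + j <= 2 * k)%N /\ (n + i + 2 * j = k * q.+1)%N) \/
  (exists i j k, (i + j + 2 * k + 3 <= m)%N /\ n = (i + 2 * j + k * q.+1 + 1)%N).
Proof.
move=> qm; pose k := (n %/ q.+1)%N; have nE := divn_eq n q.+1; rewrite -/k in nE.
have r_lt : (n %% q.+1 < q.+1)%N by rewrite ltn_mod.
move: nE r_lt; set r := (n %% q.+1)%N => nE r_lt.
have half (s : nat) : exists i j, [/\ s = (i + 2 * j)%N & (i <= 1)%N].
  exists (odd s : nat), s./2; rewrite mul2n odd_double_half; split=> //.
  by case: (odd s).
have [r0|r_gt0] := posnP r.
  by left; exists 0%N, 0%N, k; split; rewrite // nE r0; lia.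
have [s_le|s_gt] := leqP (q.+1 - r) (4 * k.+1).
  have [i [j [sE i_le]]] := half (q.+1 - r)%N.
  by left; exists i, j, k.+1; split; lia.
have [i [j [sE i_le]]] := half r.-1.
by right; exists i, j, k; split; lia.
Qed.

Local Open Scope classical_set_scope.

Theorem theorem3p9 (q m : nat) (q_pp : prime_power q) (q_odd : (2 %| q + 1)%N)
    (m_def : m = ((q + 1) %/ 2)%N) (m_ge4 : (4 <= m)%N)
    (F : finFieldType) (cardF : #|F| = (q ^ 2)%N)
    (K : closedFieldType) (iota : {rmorphism F -> K})
    (K_alg : forall c : K, algebraicOver iota c)
    (L : fieldType) (kappa : {rmorphism K -> L}) (x y : L)
    (L_fermat : fermat_function_field kappa m x y)
    (P : place kappa) (P_notin_O : ~ in_calO m x y P)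
    (P_rat : rational_place iota x y P) :
  gaps P =
    [set n : nat | exists i j k : nat,
       0 <= m%:R - 3 - i%:R - j%:R - k%:R * ((q + 1)%:R / m%:R) :> rat
       /\ n = (i + 2 * j + k * (q + 1) + 1)%N].
Proof.
have qm : q.+1 = (2 * m)%N by rewrite m_def mulnC divnK // addn1.
have q_gt1 : (1 < q)%N by lia.
have m_gt0 : (0 < m)%N by lia.
have q_pchar := pnat_pchar iota q_pp cardF.
have xO : x \in vring P.
  apply/negPn/negP => xO; apply: P_notin_O; apply: Or33; split=> //.
  apply: contra xO; exact: (fermat_vring m_gt0 (fermat_swap m_gt0 L_fermat)).
have yO := fermat_vring m_gt0 L_fermat xO.
have rational z :
    (forall S : {pred L}, x \in S -> y \in S -> z \in S) -> z \in vring P ->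
    exists2 a, z - kappa a \in max_ideal P & a ^+ (q ^ 2) = a.
  move=> z_xy zO; have [|c cM] := P_rat z _ zO.
    by move=> S _ _; apply: z_xy.
  by exists (iota c); rewrite // -rmorphXn -cardF expf_card.
have [a aM aq2] : exists2 a, x - kappa a \in max_ideal P & a ^+ (q ^ 2) = a.
  by apply: rational.
have [b bM bq2] : exists2 b, y - kappa b \in max_ideal P & b ^+ (q ^ 2) = b.
  by apply: rational.
have P_center : centered P x a y b by [].
have ab_curve := centered_curve L_fermat P_center.
have a_neq0 : a != 0.
  apply/eqP => a0; apply: P_notin_O; apply: Or32; exists b; last split=> //.
    by move: ab_curve; rewrite a0 expr0n gtn_eqF // add0r.
  by move: aM; rewrite a0 rmorph0 subr0.
have b_neq0 : b != 0.
  apply/eqP => b0; apply: P_notin_O; apply: Or31; exists a; last split=> //.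
    by move: ab_curve; rewrite b0 expr0n gtn_eqF // addr0.
  by move: bM; rewrite b0 rmorph0 subr0.
have expE (i j k : nat) :
    (0 <= m%:R - 3 - i%:R - j%:R - k%:R * ((q + 1)%:R / m%:R) :> rat)
    = (i + j + 2 * k + 3 <= m)%N.
  have -> : (q + 1)%:R / m%:R = 2 :> rat.
    by rewrite addn1 qm natrM mulfK // pnatr_eq0 -lt0n.
  rewrite -(ler_nat rat) mul2n -addnn !natrD; apply/idP/idP; lra.
have gapP := gap_of_exponents qm q_gt1 q_pchar L_fermat aq2 bq2 a_neq0 b_neq0 P_center.
apply/seteqP; split=> n /=.
  move=> n_gap; have [[i [j [k [ij nE]]]]|[i [j [k [ijk nE]]]]] := gap_arith n qm.
    case: n_gap.
    exact: (nongap_of_exponents qm q_gt1 q_pchar L_fermat aq2 bq2 a_neq0 b_neq0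
      P_center ij nE).
  by exists i, j, k; rewrite expE [(q + 1)%N]addn1.
move=> [i [j [k [ijk ->]]]]; rewrite expE in ijk; rewrite [(q + 1)%N]addn1.
exact: gapP.
Qed.
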